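(* Let $F$ be a field of characteristic $2$, let $\phi$ be either an arbitrary (possibly singular) quadratic form over $F$ or a nonsingular symmetric bilinear form over $F$, and let $L/F$ be a finite field extension. Then $N_{L/F}(G_L(\phi_L))\subseteq G_F(\phi)$.
   Context: $N_{L/F}:L\to F$ is the field norm. For a form $\psi$ over a field $E$, $G_E(\psi)=\{c\in E^*:\psi\cong c\psi\}$ is its group of similarity factors. The subscript $L$ denotes scalar extension to $L$. *)

(* Defs.v *)
From HB Require Import structures.
From mathcomp Require Import all_boot all_order all_algebra all_field.
Set Implicit Arguments. Unset Strict Implicit. Unset Printing Implicit Defensive.
Import GRing.Theory.
Local Open Scope ring_scope.

(* A quadratic form on E^n is given by any matrix A via q_A(x) = x A x^T;
   every quadratic form (in any characteristic) arises this way. *)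
Definition qf_eval (E : fieldType) (n : nat) (A : 'M[E]_n) (x : 'rV[E]_n) : E :=
  (x *m A *m x^T) 0 0.

Definition qf_isometric (E : fieldType) (n : nat) (A B : 'M[E]_n) : Prop :=
  exists P : 'M[E]_n, P \in unitmx /\ forall x, qf_eval B x = qf_eval A (x *m P).

Definition qf_simfactor (E : fieldType) (n : nat) (A : 'M[E]_n) (c : E) : Prop :=
  c != 0 /\ qf_isometric A (c *: A).

(* b_B(x,y) = x B y^T ; symmetric iff B^T = B, nonsingular iff B invertible *)
Definition bf_isometric (E : fieldType) (n : nat) (B B' : 'M[E]_n) : Prop :=
  exists P : 'M[E]_n, P \in unitmx /\ B' = P *m B *m P^T.

Definition bf_simfactor (E : fieldType) (n : nat) (B : 'M[E]_n) (c : E) : Prop :=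
  c != 0 /\ bf_isometric B (c *: B).

Definition ext_mx (F : fieldType) (L : fieldExtType F) (n : nat) (A : 'M[F]_n)
  : 'M[L]_n := map_mx (in_alg L) A.

Definition fnorm (F : fieldType) (L : fieldExtType F) (a : L) : F :=
  \det (passmx.mxof (vbasis {:L}) (vbasis {:L}) (linfun (fun x : L => a * x))).

(* Main.v *)
Require Import Defs.
From HB Require Import structures.
From mathcomp Require Import all_boot all_order all_algebra all_field.
From mathcomp Require Import zify ring.
From Stdlib Require Import Classical.
Set Implicit Arguments. Unset Strict Implicit. Unset Printing Implicit Defensive.
Import GRing.Theory.
Local Open Scope ring_scope.

(* The norm of [a] is [((-1)^d p(0))^m], where [p] is the minimal polynomial of
   [a] over [F], [d] its degree and [m = [L : F(a)]].  For [m] even this is a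
   square.  For [m] odd, a similarity [q_L ~ a q_L] is a large totally isotropic
   subspace of [q (+) -a q] over [L]; by Springer's theorem there is one of the
   same dimension over [F(a)].  Splitting off the quadratic radical and
   hyperbolic planes, one may assume that [q] is anisotropic over [F].  Then the
   pairs [(x, y)] of polynomial vectors of degree about [d / 2] whose value at
   [a] lies in that subspace form an [F]-space of dimension at least [dim q] on
   which [q(x) - t q(y)] is a constant multiple of [p]; comparing the value at
   [t = 0] with the leading coefficient in [t] gives [q ~ (-1)^d p(0) q].
   Symmetric bilinear forms are treated in the same way up to Witt equivalence;
   an isometry is recovered from Witt equivalence together with the equality of
   the diagonal quadratic forms [B(x, x)], to which the quadratic case applies. *)

(** * Totally isotropic subspaces *)

Definition bil (R : pzRingType) n (M : 'M[R]_n) (x y : 'rV[R]_n) : R :=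
  (x *m M *m y^T) 0 0.

Section Forms.
(* A matrix [A] stands for the quadratic form [x A x^T] when [b = true] and for
   the bilinear form [x A y^T], then required to be symmetric, when [b = false];
   in both cases the isotropy of a vector refers to [x A x^T]. *)
Variables (E : fieldType) (b : bool).

Definition polar n (A : 'M[E]_n) := if b then A + A^T else A.
Definition admissible n (A : 'M[E]_n) := b || (A^T == A).

(** The first clause carries the quadratic case, the second the bilinear one; keeping both lets the
    same arguments serve for either value of [b]. *)
Definition tiso n k (A : 'M[E]_n) (T : 'M[E]_(k, n)) : Prop :=
  (forall x, qf_eval A (x *m T) = 0) /\ T *m polar A *m T^T = 0.

(** Only the rank of [T] counts, not the independence of its rows, so stacked matrices and images
    can serve as witnesses directly. *)
Definition tiso_rank n (A : 'M[E]_n) (m : nat) : Prop :=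
  exists k (T : 'M[E]_(k, n)), (m <= \rank T)%N /\ tiso A T.

Definition anisotropic n (A : 'M[E]_n) : Prop :=
  forall x, qf_eval A x = 0 -> x = 0.

(** For [b = true] the quadratic radical is zero, though in characteristic 2 the polar form may
    still be degenerate; for [b = false] this is nonsingularity. *)
Definition regular_form n (A : 'M[E]_n) : Prop :=
  forall x, qf_eval A x = 0 -> x *m polar A = 0 -> x = 0.

Lemma bil_tr n (M : 'M[E]_n) x y : bil M^T x y = bil M y x.
Proof.
by rewrite /bil -[x in LHS]trmxK -!trmx_mul mulmxA mxE.
Qed.

Lemma qf_evalD n (A : 'M[E]_n) x y :
  qf_eval A (x + y) = qf_eval A x + qf_eval A y + bil (A + A^T) x y.
Proof.
have -> : bil (A + A^T) x y = bil A x y + bil A y x.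
  by rewrite -(bil_tr A x y) /bil mulmxDr mulmxDl mxE.
rewrite /qf_eval /bil linearD /= mulmxDl !mulmxDr !mulmxDl !mxE; ring.
Qed.

Lemma qf_evalZ n (A : 'M[E]_n) a x : qf_eval A (a *: x) = a ^+ 2 * qf_eval A x.
Proof. by rewrite /qf_eval linearZ /= -!scalemxAl -!scalemxAr !mxE mulrA. Qed.

Lemma qf_eval_scale n (A : 'M[E]_n) a x : qf_eval (a *: A) x = a * qf_eval A x.
Proof. by rewrite /qf_eval -scalemxAr -scalemxAl mxE. Qed.

Lemma qf_eval_mul n k (A : 'M[E]_n) (C : 'M_(k, n)) x :
  qf_eval (C *m A *m C^T) x = qf_eval A (x *m C).
Proof. by rewrite /qf_eval trmx_mul !mulmxA. Qed.

Lemma qf_eval_block n k (A : 'M[E]_n) (D : 'M[E]_k) x y :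
  qf_eval (block_mx A 0 0 D) (row_mx x y) = qf_eval A x + qf_eval D y.
Proof.
by rewrite /qf_eval mul_row_block !mulmx0 addr0 add0r tr_row_mx mul_row_col mxE.
Qed.

Lemma polar_tr n (A : 'M[E]_n) : admissible A -> (polar A)^T = polar A.
Proof.
rewrite /admissible /polar; case: b => /= [_|/eqP //].
by rewrite linearD /= trmxK addrC.
Qed.

Lemma polar_eq n (A : 'M[E]_n) :
  admissible A -> A + A^T = (if b then 1 else 2) *: polar A.
Proof.
rewrite /admissible /polar; case: b => /= [_|/eqP ->]; first by rewrite scale1r.
by rewrite scaler_nat mulr2n.
Qed.

Lemma polar_diag n (A : 'M[E]_n) x :
  qf_eval A x = 0 -> x *m polar A *m x^T = 0.
Proof.
move=> q0; apply/rowP=> j; rewrite ord1 [RHS]mxE.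
rewrite /polar; case: b => //.
have := bil_tr A x x; rewrite mulmxDr mulmxDl mxE /bil => ->.
by rewrite -/(qf_eval A x) q0 addr0.
Qed.

Lemma polarM n k (A : 'M[E]_n) (C : 'M_(k, n)) :
  polar (C *m A *m C^T) = C *m polar A *m C^T.
Proof.
rewrite /polar; case: b => //.
by rewrite mulmxDr mulmxDl !trmx_mul trmxK mulmxA.
Qed.

Lemma polar_block n k (A : 'M[E]_n) (D : 'M[E]_k) :
  polar (block_mx A 0 0 D) = block_mx (polar A) 0 0 (polar D).
Proof.
rewrite /polar; case: b => //.
by rewrite tr_block_mx !trmx0 add_block_mx !addr0.
Qed.

Lemma polarZ n (A : 'M[E]_n) a : polar (a *: A) = a *: polar A.
Proof. by rewrite /polar; case: b => //; rewrite linearZ /= scalerDr. Qed.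

Lemma admissibleM n k (A : 'M[E]_n) (C : 'M_(k, n)) :
  admissible A -> admissible (C *m A *m C^T).
Proof.
rewrite /admissible; case: b => //= /eqP sA.
by rewrite !trmx_mul trmxK sA mulmxA.
Qed.

Lemma admissible_block n k (A : 'M[E]_n) (D : 'M[E]_k) :
  admissible A -> admissible D -> admissible (block_mx A 0 0 D).
Proof.
rewrite /admissible; case: b => //= /eqP sA /eqP sD.
by rewrite tr_block_mx !trmx0 sA sD.
Qed.

Lemma admissibleZ n (A : 'M[E]_n) a : admissible A -> admissible (a *: A).
Proof. by rewrite /admissible; case: b => //= /eqP sA; rewrite linearZ /= sA. Qed.

Lemma tiso_sub n k l (A : 'M[E]_n) (T : 'M_(k, n)) (T' : 'M_(l, n)) :
  tiso A T -> (T' <= T)%MS -> tiso A T'.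
Proof.
move=> [q0 p0] /submxP [Z ->]; split=> [x|]; first by rewrite mulmxA.
by rewrite trmx_mul !mulmxA -(mulmxA Z) -(mulmxA Z) p0 mulmx0 mul0mx.
Qed.

Lemma qf_eval_shift n (A : 'M[E]_n) u x a : admissible A ->
  qf_eval A u = 0 -> u *m polar A *m x^T = 0 ->
  qf_eval A (a *: u + x) = qf_eval A x.
Proof.
move=> sA qu ux; rewrite qf_evalD qf_evalZ qu mulr0 add0r polar_eq //.
by rewrite /bil -scalemxAr -!scalemxAl ux !scaler0 mxE addr0.
Qed.

Lemma polar_perpC n k l (A : 'M[E]_n) (X : 'M_(k, n)) (Y : 'M_(l, n)) :
  admissible A -> X *m polar A *m Y^T = 0 -> Y *m polar A *m X^T = 0.
Proof.
move=> sA XY; apply: trmx_inj.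
by rewrite !trmx_mul trmxK polar_tr // mulmxA XY !trmx0.
Qed.

(** [C] represents the quotient of the orthogonal of [u] by [u], and [T] cut with that orthogonal is
    projected to it. If [u] lies in [T], the cut loses nothing and the projection loses one
    dimension; otherwise the cut loses at most one and the projection is injective. *)
Lemma tiso_rank_perp_quo n n' (A : 'M[E]_n) (u : 'rV_n) (C : 'M_(n', n)) m :
  admissible A -> qf_eval A u = 0 -> u *m polar A *m C^T = 0 ->
  u != 0 -> (kermx (polar A *m u^T) <= col_mx u C)%MS ->
  tiso_rank A m.+1 -> tiso_rank (C *m A *m C^T) m.
Proof.
move=> sA qu uC u0 kerC [k [T [rT tT]]].
set K := kermx (polar A *m u^T) in kerC.
pose X := (T :&: K)%MS.
have rX : (m <= \rank (X :\: u))%N.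
  have rk := mxrank_cap_compl X u.
  have ru : (\rank (X :&: u) <= 1)%N.
    by apply: leq_trans (mxrankS (capmxSr _ _)) (rank_leq_row u).
  have [uT | uT] := boolP (u <= T)%MS.
    suff : (\rank T <= \rank X)%N by lia.
    apply/mxrankS; rewrite sub_capmx submx_refl /=; apply/sub_kermxP.
    have [Z ->] := submxP uT; rewrite trmx_mul.
    by rewrite !mulmxA tT.2 mul0mx.
  have := mxrank_sum_cap T K; rewrite -/X => rs.
  have rK : (n.-1 <= \rank K)%N.
    by rewrite mxrank_ker; have := rank_leq_col (polar A *m u^T); lia.
  have rTK := rank_leq_col (T + K)%MS.
  suff : \rank (X :&: u) = 0%N.
    have : (0 < n)%N by apply: leq_trans (rank_leq_col u); rewrite lt0n mxrank_eq0.
    lia.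
  apply/eqP; rewrite mxrank_eq0; apply: contraNT uT => nz.
  have : (u <= X)%MS; last by move/submx_trans; apply; apply: capmxSl.
  apply: submx_trans (capmxSl X u); rewrite -(geq_leqif (mxrank_leqif_sup (capmxSr X u))).
  by rewrite (leq_trans (rank_leq_row u)) // lt0n mxrank_eq0.
have sXK : ((X :\: u) <= K)%MS by apply: submx_trans (diffmxSl _ _) (capmxSr _ _).
have tX : tiso A (X :\: u)%MS.
  by apply: tiso_sub tT _; apply: submx_trans (diffmxSl _ _) (capmxSl _ _).
have [Z defX] := submxP (submx_trans sXK kerC).
set T1 := (X :\: u)%MS in rX sXK tX defX.
have uT1 : T1 *m polar A *m u^T = 0 by rewrite -mulmxA; apply/sub_kermxP.
(* The rows of [T1] split into multiples of [u], with coefficients [al], and combinations of [C],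
   with coefficients [T']; the latter span the image in the quotient. *)
rewrite -[Z]hsubmxK mul_row_col in defX; set al := lsubmx Z in defX; set T' := rsubmx Z in defX.
have T'E : T' *m C = - (al *m u) + T1 by rewrite defX addKr.
have uT1' : u *m polar A *m T1^T = 0.
  exact: polar_perpC.
have uC' : C *m polar A *m u^T = 0.
  exact: polar_perpC.
exists _, T'; split; [|split].
(* A relation between the rows of [T'] turns the same combination of rows of [T1] into a multiple of
   [u], hence into zero, since [T1] meets [u] trivially. *)
- apply: (leq_trans rX); have := mxrank_ker T'; have := mxrank_ker T1.
  suff /mxrankS: (kermx T' <= kermx T1)%MS.
    by have := rank_leq_row T'; have := rank_leq_row T1; lia.
  apply/sub_kermxP; set W := kermx T'.
  have WT' : W *m T' = 0 by apply: mulmx_ker.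
  have : (W *m T1 <= T1 :&: u)%MS.
    rewrite sub_capmx submxMl {1}defX mulmxDr !mulmxA WT' mul0mx addr0.
    exact: submxMl.
  by rewrite capmx_diff submx0 => /eqP.
- move=> x; rewrite qf_eval_mul -mulmxA T'E mulmxDr mulmxN -mulNmx mulmxA.
  rewrite [_ *m al]mx11_scalar mul_scalar_mx qf_eval_shift ?tX.1 //.
  by rewrite trmx_mul mulmxA uT1' mul0mx.
- have H : T' *m C *m polar A *m T1^T = 0.
    by rewrite T'E !mulmxDl !mulNmx -!(mulmxA al) uT1' mulmx0 oppr0 add0r tX.2.
  rewrite polarM !mulmxA -mulmxA -trmx_mul {2}T'E linearD linearN /= mulmxDr H addr0.
  rewrite mulmxN trmx_mul !mulmxA.
  by rewrite -!(mulmxA T') uC' mul0mx mulmx0 oppr0.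
Qed.

Lemma tiso_rank_perp_lift n n' (A : 'M[E]_n) (u : 'rV_n) (C : 'M_(n', n)) m :
  admissible A -> qf_eval A u = 0 -> u *m polar A *m C^T = 0 ->
  row_free (col_mx u C) ->
  tiso_rank (C *m A *m C^T) m -> tiso_rank A m.+1.
Proof.
move=> sA qu uC fuC [k [T [rT [q0 p0]]]].
have uT : u *m polar A *m (T *m C)^T = 0.
  by rewrite trmx_mul !mulmxA uC mul0mx.
have Tu : T *m C *m polar A *m u^T = 0.
  exact: polar_perpC.
have u0 : u != 0.
  apply: contraTneq fuC => ->; rewrite -row_leq_rank -ltnNge.
  apply: leq_ltn_trans (mxrankS (_ : (_ <= C)%MS)) _; first by rewrite col_mx_sub sub0mx submx_refl.
  by rewrite ltnS rank_leq_row.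
exists (1 + k)%N, (col_mx u (T *m C)); split; [|split].
- have -> : col_mx u (T *m C) = block_mx 1%:M 0 0 T *m col_mx u C.
    by rewrite mul_block_col mul1mx !mul0mx addr0 add0r.
  by rewrite mxrankMfree // rank_diag_block_mx mxrank1 ltnS.
- move=> x; rewrite -[x]hsubmxK mul_row_col [lsubmx x]mx11_scalar mul_scalar_mx.
  rewrite mulmxA qf_eval_shift //; first by rewrite -qf_eval_mul q0.
  by rewrite -(mulmxA (rsubmx x)) [(rsubmx x *m _)^T]trmx_mul mulmxA uT mul0mx.
- rewrite mul_col_mx tr_col_mx mul_col_row polar_diag // uT Tu.
  by rewrite trmx_mul mulmxA -(mulmxA T) -(mulmxA T) -polarM p0 block_mx_const.
Qed.

(** [C] is a basis of a complement of [u] in its orthogonal: [n'] is [n - 1] when [u] is in the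
    radical of the polar form and [n - 2] otherwise. *)
Lemma exists_perp_quo n (A : 'M[E]_n) (u : 'rV_n) :
  admissible A -> qf_eval A u = 0 -> u != 0 ->
  exists n' (C : 'M_(n', n)), [/\ (n' < n)%N, u *m polar A *m C^T = 0,
    row_free (col_mx u C) & (kermx (polar A *m u^T) <= col_mx u C)%MS].
Proof.
move=> sA qu u0; set K := kermx _.
have uK : (u <= K)%MS by apply/sub_kermxP; rewrite mulmxA polar_diag.
pose C := row_base (K :\: u)%MS.
have ru : \rank u = 1%N.
  by apply/eqP; rewrite eqn_leq rank_leq_row lt0n mxrank_eq0.
have rKu := mxrank_cap_compl K u.
rewrite (capmx_idPr uK) ru in rKu.
have CK : (C <= K)%MS by rewrite eq_row_base diffmxSl.
exists _, C; split.
- by have := rank_leq_col K; lia.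
- by apply: polar_perpC => //; rewrite -mulmxA; apply/sub_kermxP.
- rewrite -row_leq_rank -addsmxE; have := mxrank_sum_cap u C.
  have -> : \rank (u :&: C) = 0%N.
    apply/eqP; rewrite mxrank_eq0 -submx0 capmxC.
    by rewrite -(capmx_diff K u); apply: capmxS; rewrite ?eq_row_base.
  by rewrite addn0 ru eq_row_base => ->.
- rewrite -(addsmx_diff_cap_eq K u) -addsmxE addsmxC.
  by apply: addsmxS; rewrite ?capmxSr ?eq_row_base.
Qed.

(** By regularity [u] pairs nontrivially with some basis vector, and [v] is that vector rescaled; it
    need not be isotropic. [C] is a basis of the orthogonal of [u] and [v]. *)
Lemma hyperbolic_split n (A : 'M[E]_n) (u : 'rV_n) :
  admissible A -> regular_form A -> qf_eval A u = 0 -> u != 0 ->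
  exists n' (v : 'rV_n) (C : 'M_(n', n)),
  [/\ u *m polar A *m v^T = 1%:M, u *m polar A *m C^T = 0, v *m polar A *m C^T = 0,
      n = n'.+2 & row_free (col_mx u (col_mx v C))].
Proof.
move=> sA nA qu u0.
have [i ui] : exists i, (u *m polar A) 0 i != 0.
  apply/rV0Pn; apply: contraNneq u0 => uS; apply/eqP; exact: nA.
set a := (_ 0 i) in ui.
pose v : 'rV[E]_n := a^-1 *: delta_mx 0 i.
have uv : u *m polar A *m v^T = 1%:M.
  apply/rowP=> j; rewrite ord1 linearZ /= trmx_delta -scalemxAr -colE mxE [col _ _ _ _]mxE.
  by rewrite -/a mulVf // mxE.
have vu : v *m polar A *m u^T = 1%:M.
  by apply: trmx_inj; rewrite !trmx_mul polar_tr // trmxK mulmxA uv trmx1.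
pose D := row_mx (polar A *m u^T) (polar A *m v^T).
pose C := row_base (kermx D).
have : C *m D = 0 by apply/sub_kermxP; rewrite eq_row_base.
rewrite mul_mx_row -row_mx0 => /eq_row_mx [Cu Cv].
have fC : row_free C := row_base_free _; clearbody C.
exists _, v, C.
have fr : row_free (col_mx u (col_mx v C)).
  apply: inj_row_free => z; rewrite -[z]hsubmxK -[rsubmx z]hsubmxK.
  set z1 := lsubmx z; set z2 := lsubmx _; set z3 := rsubmx _.
  rewrite !mul_row_col => z0.
  (* Pairing a linear relation with [u] isolates the coefficient of [v]; pairing it then with [v]
     isolates that of [u]. *)
  have := congr1 (mulmx^~ (polar A *m u^T)) z0.
  rewrite /= mul0mx !mulmxDl -!mulmxA Cu !mulmxA.
  rewrite -!(mulmxA z1) -!(mulmxA z2) vu polar_diag // !mulmx0 addr0 add0r mulmx1 => z20.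
  have := congr1 (mulmx^~ (polar A *m v^T)) z0.
  rewrite z20 /= !mul0mx !add0r !mulmxDl -!mulmxA Cv !mulmxA.
  rewrite -!(mulmxA z1) uv !mulmx0 addr0 mulmx1 => z10.
  move: z0; rewrite z10 z20 !mul0mx !add0r => z30.
  suff -> : z3 = 0 by rewrite !row_mx0.
  by apply: (row_free_inj fC); rewrite mul0mx.
split=> //.
- by apply: polar_perpC => //; rewrite -mulmxA.
- by apply: polar_perpC => //; rewrite -mulmxA.
- have := fr; rewrite -row_leq_rank => fr'.
  have := leq_trans fr' (rank_leq_col _).
  by have := mxrank_ker D; have := rank_leq_col D; lia.
Qed.

End Forms.

(** * Totally isotropic subspaces of orthogonal sums *)

Section OrthogonalSums.
Variables (E : fieldType) (b : bool).

Lemma tiso_rank0 n (A : 'M[E]_n) : tiso_rank b A 0.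
Proof.
exists 0%N, 0; split=> //; split=> [x|]; last by rewrite !mul0mx.
by rewrite mulmx0 /qf_eval !mul0mx mxE.
Qed.

Lemma tiso_rank_congr n n' (A : 'M[E]_n) (P : 'M_(n', n)) m :
  row_free P -> tiso_rank b (P *m A *m P^T) m -> tiso_rank b A m.
Proof.
move=> fP [k [T [rT [q0 p0]]]]; exists k, (T *m P); split; [|split].
- by rewrite mxrankMfree.
- by move=> x; rewrite mulmxA -qf_eval_mul.
- by rewrite trmx_mul mulmxA -(mulmxA T) -(mulmxA T) -polarM.
Qed.

Lemma tiso_rank_blockC n k (A : 'M[E]_n) (D : 'M[E]_k) m :
  tiso_rank b (block_mx A 0 0 D) m -> tiso_rank b (block_mx D 0 0 A) m.
Proof.
move=> t; apply: (@tiso_rank_congr _ (n + k) _ (block_mx 0 1%:M 1%:M 0)).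
  apply/row_freeP; exists (block_mx 0 1%:M 1%:M 0).
  by rewrite mulmx_block !mulmx0 !mul0mx !mulmx1 !add0r addr0 scalar_mx_block.
rewrite tr_block_mx !trmx0 !trmx1 !mulmx_block !mulmx0 !mul0mx !mulmx1 !mul1mx.
by rewrite !add0r !addr0.
Qed.

Lemma sub_block_perp n n' k (A : 'M[E]_n) (D : 'M[E]_k) (u : 'rV_n) (C : 'M_(n', n)) :
  (kermx (A *m u^T) <= col_mx u C)%MS ->
  (kermx (block_mx A 0 0 D *m (row_mx u 0)^T)
     <= col_mx (row_mx u 0) (block_mx C 0 0 1%:M))%MS.
Proof.
move=> kerC; rewrite tr_row_mx mul_block_col trmx0 !mulmx0 !mul0mx !addr0.
set K := kermx _; have := mulmx_ker (col_mx (A *m u^T) (0 : 'M_(k, 1))); rewrite -/K.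
rewrite -{1}[K]hsubmxK mul_row_col mulmx0 addr0 => /sub_kermxP Ku.
have [Z defK] := submxP (submx_trans Ku kerC).
apply/submxP; exists (row_mx (lsubmx Z) (row_mx (rsubmx Z) (rsubmx K))).
rewrite mul_row_col mul_mx_row mul_row_block !mulmx0 addr0 add0r mulmx1 add_row_mx add0r.
by rewrite -mul_row_col hsubmxK -defK hsubmxK.
Qed.

Lemma block_congr n n' k (A : 'M[E]_n) (D : 'M[E]_k) (C : 'M_(n', n)) :
  block_mx C 0 0 1%:M *m block_mx A 0 0 D *m (block_mx C 0 0 1%:M)^T =
  block_mx (C *m A *m C^T) 0 0 D.
Proof.
rewrite tr_block_mx !trmx0 trmx1 !mulmx_block !mulmx0 !mul0mx !mulmx1 !mul1mx.
by rewrite !(add0r, addr0, mul0mx).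
Qed.

Lemma tiso_rank_block_quo n n' k (A : 'M[E]_n) (D : 'M[E]_k) (u : 'rV_n)
    (C : 'M_(n', n)) m :
  admissible b A -> admissible b D -> qf_eval A u = 0 ->
  u *m polar b A *m C^T = 0 -> u != 0 ->
  (kermx (polar b A *m u^T) <= col_mx u C)%MS ->
  tiso_rank b (block_mx A 0 0 D) m.+1 ->
  tiso_rank b (block_mx (C *m A *m C^T) 0 0 D) m.
Proof.
move=> sA sD qu uC u0 kerC t.
rewrite -block_congr.
apply: (@tiso_rank_perp_quo _ _ _ _ _ (row_mx u 0)) t.
- exact: admissible_block.
- by rewrite qf_eval_block qu add0r /qf_eval !mul0mx mxE.
- rewrite polar_block mul_row_block !mulmx0 !mul0mx addr0 add0r.
  by rewrite tr_block_mx mul_row_block !trmx0 !mulmx0 !mul0mx uC !addr0 row_mx0.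
- by rewrite -row_mx0; apply: contra_neq u0 => /eq_row_mx [].
- by rewrite polar_block; apply: sub_block_perp.
Qed.

Lemma tiso_rank_block_lift n n' k (A : 'M[E]_n) (D : 'M[E]_k) (u : 'rV_n)
    (C : 'M_(n', n)) m :
  admissible b A -> admissible b D -> qf_eval A u = 0 ->
  u *m polar b A *m C^T = 0 -> row_free (col_mx u C) ->
  tiso_rank b (block_mx (C *m A *m C^T) 0 0 D) m ->
  tiso_rank b (block_mx A 0 0 D) m.+1.
Proof.
move=> sA sD qu uC fuC t; rewrite -block_congr in t.
apply: (@tiso_rank_perp_lift _ _ _ _ _ (row_mx u 0)) t.
- exact: admissible_block.
- by rewrite qf_eval_block qu add0r /qf_eval !mul0mx mxE.
- rewrite polar_block mul_row_block !mulmx0 !mul0mx addr0 add0r.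
  by rewrite tr_block_mx mul_row_block !trmx0 !mulmx0 !mul0mx uC !addr0 row_mx0.
- apply: inj_row_free => z; rewrite -[z]hsubmxK -[rsubmx z]hsubmxK.
  rewrite mul_row_col mul_mx_row mul_row_block !mulmx0 addr0 add0r mulmx1 add_row_mx add0r.
  rewrite -row_mx0 -mul_row_col => /eq_row_mx [z0 ->].
  have : row_mx (lsubmx z) (lsubmx (rsubmx z)) = 0.
    by apply: (row_free_inj fuC); rewrite mul0mx.
  by rewrite -row_mx0 => /eq_row_mx [-> ->]; rewrite !row_mx0.
Qed.

(** The vectors [(u, 0)] and [(0, u)] are both isotropic, and removing each of them costs at most
    one dimension. *)
Lemma tiso_rank_diff_quo n n' (A : 'M[E]_n) (u : 'rV_n) (C : 'M_(n', n)) s m :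
  s != 0 :> E -> admissible b A -> qf_eval A u = 0 ->
  u *m polar b A *m C^T = 0 -> u != 0 ->
  (kermx (polar b A *m u^T) <= col_mx u C)%MS ->
  tiso_rank b (block_mx A 0 0 (s *: A)) m.+2 ->
  tiso_rank b (block_mx (C *m A *m C^T) 0 0 (s *: (C *m A *m C^T))) m.
Proof.
move=> s0 sA qu uC u0 kerC t; apply: tiso_rank_blockC.
rewrite scalemxAl scalemxAr; apply: (@tiso_rank_block_quo _ _ _ _ _ u C) => //.
- exact: admissibleZ.
- exact: admissibleM.
- by rewrite qf_eval_scale qu mulr0.
- by rewrite polarZ -scalemxAr -scalemxAl uC scaler0.
- apply: submx_trans kerC; apply/sub_kermxP.
  have := mulmx_ker (polar b (s *: A) *m u^T).
  rewrite polarZ -scalemxAl -scalemxAr => /eqP.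
  by rewrite scaler_eq0 (negPf s0) => /eqP.
apply: tiso_rank_blockC; apply: (tiso_rank_block_quo sA _ qu uC u0 kerC t).
exact: admissibleZ.
Qed.

Lemma tiso_rank_diff_lift n n' (A : 'M[E]_n) (u : 'rV_n) (C : 'M_(n', n)) s m :
  admissible b A -> qf_eval A u = 0 ->
  u *m polar b A *m C^T = 0 -> row_free (col_mx u C) ->
  tiso_rank b (block_mx (C *m A *m C^T) 0 0 (s *: (C *m A *m C^T))) m ->
  tiso_rank b (block_mx A 0 0 (s *: A)) m.+2.
Proof.
move=> sA qu uC fuC t.
apply: (tiso_rank_block_lift sA _ qu uC fuC); first exact: admissibleZ.
apply: tiso_rank_blockC; apply: (@tiso_rank_block_lift _ _ _ _ _ u C).
- exact: admissibleZ.
- exact: admissibleM.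
- by rewrite qf_eval_scale qu mulr0.
- by rewrite polarZ -scalemxAr -scalemxAl uC scaler0.
- exact: fuC.
by apply: tiso_rank_blockC; rewrite -scalemxAr -scalemxAl.
Qed.

End OrthogonalSums.

(** * Extension of scalars and descent of isotropic subspaces *)

Section BaseChange.
Variables (K L : fieldType) (f : {rmorphism K -> L}).

Lemma qf_eval_map n (A : 'M[K]_n) x :
  qf_eval (map_mx f A) (map_mx f x) = f (qf_eval A x).
Proof. by rewrite /qf_eval map_trmx -!map_mxM mxE. Qed.

Lemma polar_map b n (A : 'M[K]_n) : polar b (map_mx f A) = map_mx f (polar b A).
Proof. by rewrite /polar; case: b => //; rewrite map_mxD map_trmx. Qed.

Lemma admissible_map b n (A : 'M[K]_n) :
  admissible b A -> admissible b (map_mx f A).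
Proof. by rewrite /admissible; case: b => //= /eqP sA; rewrite map_trmx sA. Qed.

Lemma sub_perp_map b n n' (A : 'M[K]_n) (u : 'rV_n) (C : 'M_(n', n)) :
  (kermx (polar b A *m u^T) <= col_mx u C)%MS ->
  (kermx (polar b (map_mx f A) *m (map_mx f u)^T)
     <= col_mx (map_mx f u) (map_mx f C))%MS.
Proof.
by rewrite polar_map map_trmx -map_mxM -map_kermx -map_col_mx map_submx.
Qed.

Lemma perp_map b n n' (A : 'M[K]_n) (u : 'rV_n) (C : 'M_(n', n)) :
  u *m polar b A *m C^T = 0 ->
  map_mx f u *m polar b (map_mx f A) *m (map_mx f C)^T = 0.
Proof. by rewrite polar_map map_trmx -!map_mxM => ->; rewrite map_mx0. Qed.

(* Splitting off isotropic vectors rational over [K] lowers the rank by at most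
   one, and once none is left the form stays anisotropic over [L]. *)
Lemma tiso_rank_descent b n (A : 'M[K]_n) m :
  (forall k (D : 'M[K]_k), anisotropic D -> anisotropic (map_mx f D)) ->
  admissible b A -> tiso_rank b (map_mx f A) m -> tiso_rank b A m.
Proof.
move=> anisL; elim/ltn_ind: n A m => n IHn A m sA t.
have [anA | ] := classic (anisotropic A).
  have [k [T [rT [q0 _]]]] := t.
  suff T0 : T = 0.
    by rewrite T0 mxrank0 leqn0 in rT; rewrite (eqP rT); apply: tiso_rank0.
  apply/row_matrixP=> i; rewrite row0 rowE.
  exact: anisL anA _ (q0 _).
move=> /not_all_ex_not [u Hu]; have [qu /eqP u0] := imply_to_and _ _ Hu.
case: m t => [|m] t; first exact: tiso_rank0.
have [n' [C [ltn uC fuC kerC]]] := exists_perp_quo sA qu u0.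
apply: (tiso_rank_perp_lift sA qu uC fuC); apply: IHn => //.
  exact: admissibleM.
rewrite !map_mxM -map_trmx; apply: (@tiso_rank_perp_quo _ _ _ _ _ (map_mx f u)) t.
- exact: admissible_map.
- by rewrite qf_eval_map qu rmorph0.
- exact: perp_map.
- by rewrite map_mx_eq0.
- exact: sub_perp_map.
Qed.

End BaseChange.

(** * Springer's theorem *)

Lemma bilE (R : pzRingType) n (M : 'M[R]_n) x y :
  bil M x y = \sum_j (\sum_i x 0 i * M i j) * y 0 j.
Proof. by rewrite /bil mxE; apply: eq_bigr => j _; rewrite !mxE. Qed.

Lemma bil_map (R S : pzRingType) (f : {rmorphism R -> S}) n (M : 'M[R]_n) x y :
  f (bil M x y) = bil (map_mx f M) (map_mx f x) (map_mx f y).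
Proof. by rewrite /bil map_trmx -!map_mxM [RHS]mxE. Qed.

Lemma bilDZl (R : comPzRingType) n (M : 'M[R]_n) c x y z :
  bil M (x + c *: y) z = bil M x z + c * bil M y z.
Proof. by rewrite /bil !mulmxDl -!scalemxAl [LHS]mxE [X in _ + X]mxE. Qed.

Lemma bilDZr (R : comPzRingType) n (M : 'M[R]_n) c x y z :
  bil M z (x + c *: y) = bil M z x + c * bil M z y.
Proof. by rewrite /bil linearD linearZ /= mulmxDr -!scalemxAr [LHS]mxE [X in _ + X]mxE. Qed.

Lemma bilZl (R : comPzRingType) n (M : 'M[R]_n) c y z :
  bil M (c *: y) z = c * bil M y z.
Proof. by rewrite /bil -!scalemxAl mxE. Qed.

Lemma bilZr (R : comPzRingType) n (M : 'M[R]_n) c y z :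
  bil M z (c *: y) = c * bil M z y.
Proof. by rewrite /bil linearZ /= -!scalemxAr mxE. Qed.

Lemma coefM_top (R : nzRingType) (p q : {poly R}) s r :
  (size p <= s.+1)%N -> (size q <= r.+1)%N -> (p * q)`_(s + r) = p`_s * q`_r.
Proof.
move=> sp sq; have lts : (s < (s + r).+1)%N by rewrite ltnS leq_addr.
rewrite coefM (bigD1 (Ordinal lts)) //= addKn big1 ?addr0 // => j.
rewrite -val_eqE /= => js; have [ltj|lej] := ltnP j s.
  by rewrite (nth_default _ (_ : size q <= _)%N) ?mulr0 // (leq_trans sq) //; lia.
by rewrite nth_default ?mul0r // (leq_trans sp) //; lia.
Qed.

Section PolynomialVectors.
Variables (K : fieldType) (n : nat).
Implicit Types (A M : 'M[K]_n) (f g : 'rV[{poly K}]_n).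

Definition coef_rV s f : 'rV[K]_n := map_mx (fun p : {poly K} => p`_s) f.

Lemma size_bil M f g s r :
  (forall i, (size (f 0 i)%R <= s)%N) -> (forall i, (size (g 0 i)%R <= r)%N) ->
  (size (bil (map_mx polyC M) f g) <= (s + r).-1)%N.
Proof.
move=> sf sg; rewrite bilE; apply: (leq_trans (size_sum _ _ _)).
apply/bigmax_leqP=> j _; apply: (leq_trans (size_polyMleq _ _)).
suff : (size (\sum_i f 0 i * (map_mx polyC M) i j)%R <= s)%N.
  by move=> le_s; rewrite -!subn1 leq_sub2r // leq_add.
apply: (leq_trans (size_sum _ _ _)); apply/bigmax_leqP=> i _.
rewrite mxE mulrC mul_polyC; apply: leq_trans (sf i); exact: size_scale_leq.
Qed.

Lemma coef_bil_top M f g s r :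
  (forall i, (size (f 0 i)%R <= s.+1)%N) -> (forall i, (size (g 0 i)%R <= r.+1)%N) ->
  (bil (map_mx polyC M) f g)`_(s + r) = bil M (coef_rV s f) (coef_rV r g).
Proof.
move=> sf sg; rewrite !bilE coef_sum; apply: eq_bigr => j _.
have sfM i : (size (f 0 i * (map_mx polyC M) i j)%R <= s.+1)%N.
  by rewrite mxE mulrC mul_polyC; apply: leq_trans (sf i); exact: size_scale_leq.
rewrite coefM_top //; last first.
  by apply: (leq_trans (size_sum _ _ _)); apply/bigmax_leqP.
rewrite coef_sum [in RHS]mxE; congr (_ * _); apply: eq_bigr => i _.
by rewrite mxE mxE coefMC.
Qed.

(** If [s] is the largest degree of an entry, the vector of coefficients of degree [s] is nonzero,
    so by anisotropy the coefficient of degree [2 s] of the value cannot cancel. *)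
Lemma size_qf_anisotropic A f : anisotropic A -> f != 0 ->
  exists s, [/\ forall i, (size (f 0 i)%R <= s.+1)%N,
                exists i, size (f 0 i)%R = s.+1 &
                size (bil (map_mx polyC A) f f) = s.*2.+1].
Proof.
move=> anA /rV0Pn [i0 fi0].
have n0 : (0 < #|'I_n|)%N by rewrite card_ord (leq_trans _ (ltn_ord i0)).
have [i1 Hi1] := eq_bigmax (fun i => size (f 0 i)) n0.
have lei i : (size (f 0 i)%R <= size (f 0 i1)%R)%N.
  by rewrite -Hi1; apply: leq_bigmax.
have : (0 < size (f 0 i1)%R)%N by apply: leq_trans (lei i0); rewrite size_poly_gt0.
case E: (size (f 0 i1)) => [//|s] _.
have sf i : (size (f 0 i)%R <= s.+1)%N by rewrite -E.
exists s; split=> //; first by exists i1.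
apply/eqP; rewrite eqn_leq; apply/andP; split.
  by apply: (leq_trans (size_bil A sf sf)); lia.
rewrite ltnNge; apply/negP => /leq_sizeP /(_ s.*2 (leqnn _)).
rewrite -addnn coef_bil_top // => /anA /rowP /(_ i1); rewrite !mxE => /eqP.
by apply/negP; rewrite -[s]/(s.+1.-1) -E -lead_coefE lead_coef_eq0 -size_poly_eq0 E.
Qed.

(** Euclid's algorithm: among the nonzero values [f *m h], one of least degree divides every entry
    of [f], for otherwise a remainder would be a smaller value. *)
Lemma poly_rV_gcd f : f != 0 ->
  exists (g : {poly K}) (f' : 'rV_n) (h : 'cV_n),
    [/\ g != 0, f = g *: f' & f' *m h = 1%:M].
Proof.
move=> f0.
have [h0 fh0] : exists h : 'cV_n, (f *m h) 0 0 != 0.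
  have /rV0Pn [i fi] := f0; exists (delta_mx i 0); by rewrite -colE mxE.
have [s] := ubnP (size ((f *m h0) 0 0)); elim: s h0 fh0 => // s IHs h gh les.
set g := (_ 0 0) in gh les; have [dvd | ] := boolP [forall i, g %| f 0 i].
  have fg : f = g *: map_mx (fun p => p %/ g) f.
    by apply/rowP=> i; rewrite !mxE mulrC divpK // (forallP dvd).
  exists g, (map_mx (fun p => p %/ g) f), h; split=> //.
  apply/rowP=> j; rewrite ord1 [RHS]mxE; apply: (mulfI gh).
  by transitivity ((f *m h) 0 0); rewrite ?mulr1 // [in RHS]fg -scalemxAl [RHS]mxE.
move=> /forallPn [i ndvd].
have fh' : (f *m (delta_mx i 0 - (f 0 i %/ g) *: h)) 0 0 = f 0 i %% g.
  rewrite mulmxBr -colE -scalemxAr [LHS]mxE [X in X + _]mxE [X in _ + X]mxE [X in - X]mxE.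
  by rewrite -/g {1}(divp_eq (f 0 i) g) addrC addKr.
apply: (IHs (delta_mx i 0 - (f 0 i %/ g) *: h)); rewrite fh'.
  by move: ndvd; rewrite /dvdp.
by rewrite ltnS in les; apply: leq_trans les; rewrite ltn_modp.
Qed.

(* The odd-degree descent of Springer's theorem: reduce [f] modulo [p] and
   divide by the content, so that [q(f) / p] is a polynomial of odd degree
   smaller than that of [p]. *)
Lemma springer_descent A (p : {poly K}) f (h : 'cV_n) :
  anisotropic A -> p != 0 -> ~~ odd (size p) ->
  p %| bil (map_mx polyC A) f f -> coprimep p ((f *m h) 0 0) -> False.
Proof.
move=> anA; have [s] := ubnP (size p); elim: s p f h => // s IHs p f h les p0 op dvd co.
pose md := map_mx (fun r => r %% p).
pose f1 := md _ _ f.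
have f1E : f1 = f - p *: map_mx (fun r => r %/ p) f.
  by apply/rowP=> i; rewrite !mxE [X in _ = X - _](divp_eq (f 0 i) p); ring.
have dvd1 : p %| bil (map_mx polyC A) f1 f1.
  have -> : bil (map_mx polyC A) f1 f1 = bil (map_mx polyC A) f f
     - p * bil (map_mx polyC A) f (map_mx (fun r => r %/ p) f)
     - p * bil (map_mx polyC A) (map_mx (fun r => r %/ p) f) f1.
    by rewrite f1E -scaleNr bilDZl !bilDZr; ring.
  by rewrite !dvdp_sub // dvdp_mulIl.
have co1 : coprimep p ((f1 *m h) 0 0).
  have -> : (f1 *m h) 0 0 = - (map_mx (fun r => r %/ p) f *m h) 0 0 * p + (f *m h) 0 0.
    rewrite f1E mulmxDl mulNmx -scalemxAl [LHS]mxE [X in _ + X]mxE [X in - X]mxE; ring.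
  by rewrite coprimep_addl_mul.
have f10 : f1 != 0.
  apply: contraTneq co1 => ->; rewrite mul0mx mxE coprimep0.
  by apply: contraNN op; rewrite -size_poly_eq1 => /eqP ->.
have [g [f2 [h2 [g0 f1g f2h]]]] := poly_rV_gcd f10.
(* The content [g] divides [f1 *m h], which is prime to [p]; so dividing by [g] keeps the
   divisibility of the value by [p]. *)
have copg : coprimep p g.
  by move: co1; rewrite f1g -scalemxAl mxE coprimepMr => /andP [].
have dvd2 : p %| bil (map_mx polyC A) f2 f2.
  move: dvd1; rewrite f1g /bil linearZ /= -!scalemxAl -!scalemxAr !mxE.
  by rewrite !(Gauss_dvdpr _ copg).
have f20 : f2 != 0 by apply: contraNneq f10 => e; rewrite f1g e scaler0.
have [t [st [i sti] sq]] := size_qf_anisotropic anA f20.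
have [r Er] := dvdpP _ _ dvd2.
have ltt : (t.+1 < size p)%N.
  rewrite -sti; apply: (@leq_ltn_trans (size (f1 0 i))).
    have nz : f2 0 i != 0 by rewrite -size_poly_eq0 sti.
    rewrite f1g mxE size_mul // addnC -subn1 -addnBA ?leq_addr //.
    by rewrite size_poly_gt0.
  by rewrite mxE ltn_modp.
have r0 : r != 0 by apply: contra_eqN sq => /eqP r0; rewrite Er r0 mul0r size_poly0.
(* The sizes of [r] and [p] add up to [2 t + 2], so [size r] is again even, and it is smaller than
   [size p] because [t + 1 < size p]. The cofactor [r] may be reducible, which is why the induction
   assumes coprimality with a value of [f] rather than irreducibility. *)
have sr : (size r + size p).-1 = t.*2.+1 by rewrite -sq Er size_mul.
apply: (IHs r f2 h2) => //.
- by lia.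
- by lia.
- by rewrite Er dvdp_mulIl.
- by rewrite f2h mxE coprimep1.
Qed.
End PolynomialVectors.

Section OddExtensions.
Variables (F : fieldType) (L : fieldExtType F).
Implicit Types (E : {subfield L}).

(** Stated inside [L], so that climbing a tower of subfields involves no change of type. *)
Definition anisotropic_on E n (A : 'M[L]_n) : Prop :=
  forall x : 'rV[L]_n, (forall i, x 0 i \in E) -> qf_eval A x = 0 -> x = 0.

Lemma map_vsvalK E m n (A : 'M[L]_(m, n)) : (forall i j, A i j \in E) ->
  map_mx vsval (map_mx (vsproj E) A) = A.
Proof. by move=> AE; apply/matrixP=> i j; rewrite !mxE vsprojK. Qed.

Lemma map_poly_vsvalK E (p : {poly L}) : p \is a polyOver E ->
  map_poly vsval (map_poly (vsproj E) p) = p.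
Proof.
move=> /polyOverP pE; apply/polyP=> i.
by rewrite coef_map /= coef_map_id0 ?linear0 //= vsprojK.
Qed.

(** An isotropic vector over [E(b)] lifts to a vector of polynomials in [b], whose value is
    divisible by the minimal polynomial [p] of [b]. Odd degree means even [size p], so the descent
    applies. *)
Lemma anisotropic_on_adjoin E (b : L) n (A : 'M[L]_n) :
  (forall i j, A i j \in E) -> odd (adjoin_degree E b) ->
  anisotropic_on E A -> anisotropic_on <<E; b>>%AS A.
Proof.
move=> AE odd_b anA x xE qx; apply: NNPP => /eqP x0.
pose A' := map_mx (vsproj E) A.
have A'E : map_mx vsval A' = A by apply: map_vsvalK.
have anA' : anisotropic A'.
  move=> y qy; suff : map_mx vsval y = 0.
    by move/eqP; rewrite map_mx_eq0 => /eqP.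
  apply: anA => [i|]; first by rewrite mxE subvsP.
  by rewrite -A'E qf_eval_map qy.
pose lift p := map_poly (vsproj E) p.
pose ev : {rmorphism {poly subvs_of E} -> L} := horner_eval b \o map_poly vsval.
have evE p : ev p = (map_poly vsval p).[b] by [].
have ev_lift v : v \in <<E; b>>%VS -> ev (lift (Fadjoin_poly E b v)) = v.
  by move=> vE; rewrite evE map_poly_vsvalK ?Fadjoin_polyOver // Fadjoin_poly_eq.
pose p := lift (minPoly E b).
have pE : map_poly vsval p = minPoly E b by rewrite map_poly_vsvalK ?minPolyOver.
have dvd_p g : ev g = 0 -> p %| g.
  move=> g0; rewrite -(dvdp_map (vsval : {rmorphism subvs_of E -> L})) pE.
  apply: minPoly_dvdp; last by rewrite /root -evE g0.
  by apply/polyOver_subvs; exists g.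
have sp : size p = (adjoin_degree E b).+1.
  by rewrite -(size_map_poly (vsval : {rmorphism subvs_of E -> L})) pE size_minPoly.
pose f : 'rV_n := map_mx (fun v => lift (Fadjoin_poly E b v)) x.
have evf : map_mx ev f = x.
  by apply/rowP=> i; rewrite !mxE ev_lift // xE.
have /rV0Pn [i xi] := x0.
(* [h] selects a nonzero entry of [x] and multiplies by a lift of its inverse, so that [f *m h] is
   congruent to 1 modulo [p]. *)
pose h : 'cV_n := delta_mx i 0 *m (lift (Fadjoin_poly E b (x 0 i)^-1))%:M.
apply: (@springer_descent _ _ A' p f h) => //.
- by rewrite -size_poly_eq0 sp.
- by rewrite sp oddS odd_b.
- apply: dvd_p; rewrite bil_map evf -/(qf_eval _ _) -[RHS]qx -A'E.
  congr (qf_eval _ _); apply/matrixP=> k l; rewrite !mxE /= map_polyC /=.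
  by rewrite /horner_eval hornerC.
- have fh : (f *m h) 0 0 = f 0 i * lift (Fadjoin_poly E b (x 0 i)^-1).
    by rewrite mulmxA -colE mul_mx_scalar mxE mulrC [col _ _ _ _]mxE.
  have /dvdpP [r Er] : p %| (f *m h) 0 0 - 1.
    apply: dvd_p; rewrite rmorphB rmorph1 fh rmorphM.
    by rewrite ev_lift ?rpredV ?xE // mxE ev_lift ?xE // mulfV // subrr.
  have -> : (f *m h) 0 0 = r * p + 1 by rewrite -Er subrK.
  by rewrite coprimep_addl_mul coprimep1.
Qed.

(** Climb from [E] to [L] by adjoining one element at a time; by multiplicativity of degrees every
    step has odd degree. *)
Lemma anisotropic_on_odd E n (A : 'M[L]_n) : odd (\dim_E {:L}) ->
  (forall i j, A i j \in E) -> anisotropic_on E A -> anisotropic A.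
Proof.
have [s] := ubnP (\dim {:L} - \dim E)%N; elim: s E => // s IHs E les oddE AE anE.
have [Lx | ] := eqVneq E {:L}%AS.
  by move=> x; apply: anE => i; rewrite Lx memvf.
move=> neL; have [b bE] : exists b, b \notin E.
  apply: NNPP => H; move/eqP: neL; apply; apply/val_inj/vspaceP=> v /=.
  by rewrite memvf; apply: contra_notT H => vE; exists v.
have sE : (E <= <<E; b>>)%VS by apply: subv_adjoin.
have d1 := dim_Fadjoin E b.
have d2 := dim_sup_field (subvf E).
have d3 := dim_sup_field (subvf <<E; b>>%AS).
have mul : (\dim_E {:L} = \dim_(<<E; b>>) {:L} * adjoin_degree E b)%N.
  by apply/eqP; rewrite -(eqn_pmul2r (adim_gt0 E)) -d2 {1}d3 /= d1 mulnA.
rewrite mul oddM in oddE; have [odd1 odd2] := andP oddE.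
apply: (IHs <<E; b>>%AS) => //.
- have ltd : (\dim E < \dim <<E; b>>)%N.
    rewrite ltn_neqAle (dimv_leqif_sup sE).1 andbT (dimv_leqif_sup sE).2.
    by apply: contra bE => /subvP; apply; apply: memv_adjoin.
  rewrite ltnS in les; apply: leq_trans les; apply: ltn_sub2l => //.
  exact: leq_trans ltd (dimvS (subvf _)).
- by move=> i j; rewrite (subvP sE).
- exact: anisotropic_on_adjoin.
Qed.

Lemma springer E n (A : 'M[subvs_of E]_n) : odd (\dim_E {:L}) ->
  anisotropic A -> anisotropic (map_mx vsval A).
Proof.
move=> oddE anA; apply: (anisotropic_on_odd oddE) => [i j|x xE qx].
  by rewrite mxE subvsP.
have xK : map_mx vsval (map_mx (vsproj E) x) = x.
  by apply: map_vsvalK => i j; rewrite ord1.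
move/eqP: qx; rewrite -xK qf_eval_map fmorph_eq0 => /eqP /anA ->.
by rewrite map_mx0.
Qed.
End OddExtensions.

(** * Transfer from F(a) to F *)

Section PolynomialLattice.
Variables (F : fieldType) (n d : nat) (p : {poly F}).
Hypotheses (p_monic : p \is monic) (size_p : size p = d.+1).
Implicit Types (x y : 'rV[{poly F}]_n) (M : 'M[F]_n).

Definition bounded s x := forall i, (size (x 0 i)%R <= s)%N.

(** The vector that determines the coefficient of [t^d] in [q(x) - t q(y)]: for [d] even it comes
    from [x], for [d] odd from [y], in degree [d./2] either way. *)
Definition lead_rV x y : 'rV[F]_n := coef_rV d./2 (if odd d then y else x).

(** The form [M (+) -t M] over [F[t]], which specialises at [t = a] to [M (+) -a M]. *)
Definition diff_bil M x y x' y' : {poly F} :=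
  bil (map_mx polyC M) x x' - 'X * bil (map_mx polyC M) y y'.

(** The degree bounds keep the polynomial in degree at most [d], so its quotient by the monic [p] of
    degree [d] is a constant, namely the coefficient of degree [d]. The factor [-t] in front of the
    [y] term produces the sign when [d] is odd. *)
Lemma diff_bil_lead M x y x' y' :
  bounded d./2.+1 x -> bounded (uphalf d) y ->
  bounded d./2.+1 x' -> bounded (uphalf d) y' ->
  p %| diff_bil M x y x' y' ->
  diff_bil M x y x' y' = ((-1) ^+ d * bil M (lead_rV x y) (lead_rV x' y')) *: p.
Proof.
move=> bx yb bx' yb' dvd; set H := diff_bil _ _ _ _ _ in dvd *.
have dE := odd_double_half d; have uE := uphalf_half d.
have sx : (size (bil (map_mx polyC M) x x') <= (d./2).*2.+1)%N.
  by apply: leq_trans (size_bil M bx bx') _; lia.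
have sy : (size ('X * bil (map_mx polyC M) y y')%R <= (uphalf d).*2)%N.
  case: (uphalf d) yb yb' => [|u] yb yb'.
    suff -> : y = 0 by rewrite /bil !mul0mx mxE mulr0 size_poly0.
    by apply/rowP=> i; apply/eqP; rewrite mxE -size_poly_leq0.
  apply: leq_trans (size_polyMleq _ _) _; rewrite size_polyX add2n /=.
  by rewrite (leq_ltn_trans (size_bil M yb yb')) //; lia.
have sH : (size H <= d.+1)%N.
  apply: leq_trans (size_polyD _ _) _; rewrite geq_max size_polyN.
  by rewrite (leq_trans sx) ?(leq_trans sy) //; lia.
have Hd : H`_d = (-1) ^+ d * bil M (lead_rV x y) (lead_rV x' y').
  rewrite coefB coefXM /lead_rV; case: (boolP (odd d)) dE uE => od dE uE.
    rewrite nth_default; last by apply: leq_trans sx _; lia.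
    have -> : (d == 0)%N = false by lia.
    rewrite sub0r -signr_odd od expr1 mulN1r; congr (- _).
    have -> : (d.-1 = d./2 + d./2)%N by lia.
    by rewrite coef_bil_top //; rewrite /bounded -[d./2.+1]uE.
  rewrite -signr_odd (negPf od) expr0 mul1r.
  have {1}-> : (d = d./2 + d./2)%N by lia.
  rewrite coef_bil_top //; case: eqP => [_|d0]; first by rewrite subr0.
  by rewrite nth_default ?subr0 // (leq_trans (size_bil M yb yb')) //; lia.
have [r Er] := dvdpP _ _ dvd.
have p0 := monic_neq0 p_monic.
have sr : (size r <= 1)%N.
  have [-> |r0] := eqVneq r 0; first by rewrite size_poly0.
  by move: sH; rewrite Er size_mul // size_p addnS /= -add1n leq_add2r.
rewrite (size1_polyC sr) mul_polyC in Er.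
rewrite -Hd Er coefZ; have := monicP p_monic; rewrite lead_coefE size_p /= => ->.
by rewrite mulr1.
Qed.

Lemma coef0_diff_bil M x y x' y' :
  (diff_bil M x y x' y')`_0 = bil M (coef_rV 0 x) (coef_rV 0 x').
Proof.
rewrite coefB coefXM /= subr0 -horner_coef0 -/(horner_eval 0 _) bil_map.
congr bil; apply/matrixP=> i j; rewrite !mxE;
  by rewrite /= /horner_eval ?hornerC ?horner_coef0.
Qed.

(** By anisotropy a nonzero [q(x)] has even degree and a nonzero [t q(y)] odd degree, so they cannot
    cancel. *)
Lemma diff_bil_eq0 A x y : anisotropic A -> diff_bil A x y x y = 0 ->
  x = 0 /\ y = 0.
Proof.
move=> anA /eqP; rewrite subr_eq0 => /eqP e.
have [y0 | y0] := eqVneq y 0.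
  split=> //; apply: NNPP => /eqP x0.
  have [s [_ _]] := size_qf_anisotropic anA x0.
  by rewrite e y0 /bil !mul0mx mxE mulr0 size_poly0.
have [s [_ _ sy]] := size_qf_anisotropic anA y0.
have bil0 : bil (map_mx polyC A) y y != 0 by rewrite -size_poly_eq0 sy.
have sX : size ('X * bil (map_mx polyC A) y y) = s.*2.+2.
  by rewrite mulrC size_mulX // sy.
have [x0 | x0] := eqVneq x 0.
  by move: sX; rewrite -e x0 /bil !mul0mx mxE size_poly0.
have [t [_ _]] := size_qf_anisotropic anA x0.
by rewrite e sX => /(congr1 odd); rewrite /= !odd_double.
Qed.

End PolynomialLattice.

Section EvaluationSystem.
Variables (F : fieldType) (K : fieldExtType F) (a : K) (n r s1 s2 : nat).
Variable D : 'M[K]_(n + n, r).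

Definition rV_of_coefs s (U : 'M[F]_(n, s)) : 'rV[{poly F}]_n :=
  \row_j rVpoly (row j U).

(** The columns of [D] are linear equations over [K]. The target consists of finite functions so as
    to be a vector space over [F] rather than over [K]. *)
Definition eval_system (w : 'M[F]_(n, s1) * 'M[F]_(n, s2)) : {ffun 'I_r -> K} :=
  [ffun i => (row_mx (map_mx (horner_alg a) (rV_of_coefs w.1))
                     (map_mx (horner_alg a) (rV_of_coefs w.2)) *m D) 0 i].

Lemma rV_of_coefs_linear s c (U V : 'M[F]_(n, s)) :
  rV_of_coefs (c *: U + V) = c%:P *: rV_of_coefs U + rV_of_coefs V.
Proof.
by apply/rowP=> j; rewrite !mxE linearP /= linearP /= mul_polyC.
Qed.

Lemma rV_of_coefs_sum s (U : 'I_n -> 'M[F]_(n, s)) (z : 'rV_n) :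
  map_mx polyC z *m (\matrix_i rV_of_coefs (U i)) =
  rV_of_coefs (\sum_i z 0 i *: U i).
Proof.
apply/rowP=> j; rewrite !mxE !linear_sum; apply: eq_bigr => i _.
by rewrite !mxE linearZ /= linearZ /= mul_polyC.
Qed.

Lemma rV_of_coefs_eq0 s (U : 'M[F]_(n, s)) : rV_of_coefs U = 0 -> U = 0.
Proof.
move=> /rowP U0; apply/row_matrixP=> j; rewrite row0.
by have := U0 j; rewrite !mxE => /(congr1 (@poly_rV _ s)); rewrite rVpolyK linear0.
Qed.

Fact eval_system_linear : linear eval_system.
Proof.
move=> c w w'; apply/ffunP=> i; rewrite !ffunE /= !rV_of_coefs_linear.
rewrite !map_mxD !map_mxZ /= -!add_row_mx -!scale_row_mx mulmxDl -scalemxAl !mxE.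
by rewrite horner_algC mulr_algl.
Qed.

HB.instance Definition _ :=
  GRing.isSemilinear.Build F _ _ _ eval_system
    (GRing.semilinear_linear eval_system_linear).

(** With [d] the degree of [K], there are [n (d + 1)] unknowns in [F] and [r d <= n d] equations,
    hence at least [n] independent solutions; they form the rows of [X] and [Y]. *)
Lemma eval_system_kernel : (r <= n)%N -> (s1 + s2 = (\dim {:K}).+1)%N ->
  exists X Y : 'M[{poly F}]_n,
  [/\ forall i, bounded s1 (row i X), forall i, bounded s2 (row i Y),
      row_mx (map_mx (horner_alg a) X) (map_mx (horner_alg a) Y) *m D = 0 &
      forall z, map_mx polyC z *m X = 0 -> map_mx polyC z *m Y = 0 -> z = 0 :> 'rV_n].
Proof.
move=> ler dims; pose phi := linfun eval_system.
have dimk : (n <= \dim (lker phi))%N.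
  have dim_dom : \dim {: ('M[F]_(n, s1) * 'M[F]_(n, s2))%type} = (n * s1 + n * s2)%N.
    by rewrite dimvf.
  have dim_cod : \dim {: {ffun 'I_r -> K}} = (r * \dim {:K})%N.
    by rewrite !dimvf -[LHS]/(#|'I_r| * _)%N card_ord.
  have := limg_ker_dim phi fullv; rewrite capfv dim_dom -mulnDr dims.
  have := dimvS (subvf (limg phi)); rewrite dim_cod.
  have : (r * \dim {:K} <= n * \dim {:K})%N by rewrite leq_mul2r ler orbT.
  move: (\dim (lker phi)) (\dim (limg phi)) (\dim {:K}) => k l d; lia.
have size_t : size (take n (vbasis (lker phi))) == n.
  by rewrite size_takel // size_tuple.
pose t := Tuple size_t.
have free_t : free t.
  have := basis_free (vbasisP (lker phi)).
  by rewrite -{1}(cat_take_drop n (vbasis _)) => /catl_free.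
have ker_t (i : 'I_n) : t`_i \in lker phi.
  rewrite nth_take // vbasis_mem // mem_nth // size_tuple.
  exact: leq_trans (ltn_ord i) dimk.
exists (\matrix_i rV_of_coefs (t`_i).1), (\matrix_i rV_of_coefs (t`_i).2); split.
- by move=> i j; rewrite rowK mxE size_poly.
- by move=> i j; rewrite rowK mxE size_poly.
- apply/row_matrixP=> i; rewrite row0 row_mul row_row_mx -!map_row !rowK.
  apply/rowP=> j; have := ker_t i; rewrite memv_ker lfunE /= => /eqP/ffunP/(_ j).
  by rewrite !ffunE => ->; rewrite mxE.
- move=> z zX zY.
  have z0 : \sum_i z 0 i *: t`_i = 0.
    rewrite rV_of_coefs_sum in zX; rewrite rV_of_coefs_sum in zY.
    rewrite [LHS]surjective_pairing.
    rewrite (big_morph fst (fun _ _ => erefl) erefl).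
    rewrite (big_morph snd (fun _ _ => erefl) erefl).
    by rewrite (rV_of_coefs_eq0 zX) (rV_of_coefs_eq0 zY).
  have /freeP free_z := free_t.
  by apply/rowP=> i; rewrite (free_z (fun i => z 0 i) z0 i) mxE.
Qed.
End EvaluationSystem.

Lemma bounded_combination (F : fieldType) n s (X : 'M[{poly F}]_n) (z : 'rV[F]_n) :
  (forall i, bounded s (row i X)) -> bounded s (map_mx polyC z *m X).
Proof.
move=> bX j; rewrite mxE; apply: (leq_trans (size_sum _ _ _)).
apply/bigmax_leqP=> i _; rewrite mxE mul_polyC.
by apply: leq_trans (size_scale_leq _ _) _; have := bX i j; rewrite mxE.
Qed.

Lemma coef_combination (F : fieldType) n s (X : 'M[{poly F}]_n) (z : 'rV[F]_n) :
  coef_rV s (map_mx polyC z *m X) = z *m map_mx (fun f : {poly F} => f`_s) X.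
Proof.
apply/rowP=> j; rewrite !mxE coef_sum; apply: eq_bigr => i _.
by rewrite !mxE coefCM.
Qed.

Lemma bil_delta (R : pzRingType) n (M : 'M[R]_n) i j :
  bil M (delta_mx 0 i) (delta_mx 0 j) = M i j.
Proof. by rewrite /bil trmx_delta -rowE -colE !mxE. Qed.

Lemma bil_mul (R : comPzRingType) n k (M : 'M[R]_n) (C : 'M_(k, n)) x y :
  bil M (x *m C) (y *m C) = bil (C *m M *m C^T) x y.
Proof. by rewrite /bil trmx_mul !mulmxA. Qed.

Section Transfer.
Variables (F : fieldType) (K : fieldExtType F) (a : K) (p : {poly F}).
Local Notation d := (\dim {:K}).
Hypotheses (p_monic : p \is monic) (size_p : size p = d.+1).
Hypothesis p_min : forall f, horner_alg a f = 0 -> p %| f.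
Local Notation c := ((-1) ^+ d * p`_0).

(* [T] cuts out a lattice of pairs [(x, y)] over [F[t]] on which
   [(q(x) - t q(y)) / p] is a constant form of rank [n]; specialising it at
   [t = 0] and at [t = oo] gives [q / p(0)] and [+/- q]. *)
Lemma transfer_anisotropic b n (A : 'M[F]_n) :
  c != 0 -> admissible b A -> anisotropic A ->
  tiso_rank b (block_mx (map_mx (in_alg K) A) 0 0 (- a *: map_mx (in_alg K) A)) n ->
  exists P : 'M_n, [/\ P \in unitmx, forall x, qf_eval A (x *m P) = c * qf_eval A x &
    P *m polar b A *m P^T = c *: polar b A].
Proof.
move=> c0 sA anA [k [T [rT [q0 pol0]]]].
(* The columns of [D] are equations of the row space of [T]; there are at most [n] of them, since
   [T] has rank at least [n] in dimension [2 n]. *)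
pose D := col_base (cokermx T).
have TD w : w *m D = 0 -> (w <= T)%MS.
  by move=> wD; rewrite submxE -(mulmx_base (cokermx T)) mulmxA wD mul0mx.
have rD : (\rank (cokermx T) <= n)%N by rewrite mxrank_coker; lia.
have ds : (d./2.+1 + uphalf d = d.+1)%N.
  by have := odd_double_half d; have := uphalf_half d; lia.
have [X [Y [bX bY XYD XY0]]] := eval_system_kernel a D rD ds.
pose ev : {rmorphism {poly F} -> K} := horner_alg a.
have {}XYD : row_mx (map_mx ev X) (map_mx ev Y) *m D = 0 by [].
have evC e : ev e%:P = e%:A by exact: horner_algC.
have evX : ev 'X = a by exact: horner_algX.
have ev_form M x y x' y' : ev (diff_bil M x y x' y') =
    bil (block_mx (map_mx (in_alg K) M) 0 0 (- a *: map_mx (in_alg K) M))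
      (row_mx (map_mx ev x) (map_mx ev y)) (row_mx (map_mx ev x') (map_mx ev y')).
  rewrite /bil mul_row_block !mulmx0 addr0 add0r tr_row_mx mul_row_col.
  rewrite -scalemxAr -scalemxAl [RHS]mxE [X in _ + X]mxE -!/(bil _ _ _).
  have evM : map_mx (in_alg K) M = map_mx ev (map_mx polyC M).
    by apply/matrixP=> i j; rewrite !mxE evC.
  by rewrite evM -!bil_map /diff_bil rmorphB rmorphM /= evX mulNr.
pose xz (z : 'rV[F]_n) := map_mx polyC z *m X.
pose yz (z : 'rV[F]_n) := map_mx polyC z *m Y.
have bxz z : bounded d./2.+1 (xz z) by apply: bounded_combination.
have byz z : bounded (uphalf d) (yz z) by apply: bounded_combination.
have sub_T z : (row_mx (map_mx ev (xz z)) (map_mx ev (yz z)) <= T)%MS.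
  by apply: TD; rewrite !map_mxM -mul_mx_row -mulmxA XYD mulmx0.
have evq z : p %| diff_bil A (xz z) (yz z) (xz z) (yz z).
  apply: p_min; rewrite ev_form.
  have /submxP [Z ->] := sub_T z; exact: q0.
have evpol z z' : p %| diff_bil (polar b A) (xz z) (yz z) (xz z') (yz z').
  apply: p_min; rewrite ev_form.
  have /submxP [Z ->] := sub_T z; have /submxP [Z' ->] := sub_T z'.
  rewrite /bil -polar_map -polarZ -polar_block trmx_mul !mulmxA.
  by rewrite -(mulmxA Z) -(mulmxA Z) pol0 mulmx0 mul0mx mxE.
pose X0 := map_mx (fun f : {poly F} => f`_0) X.
pose Z := map_mx (fun f : {poly F} => f`_(d./2)) (if odd d then Y else X).
have X0E z : z *m X0 = coef_rV 0 (xz z) by rewrite coef_combination.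
have ZE z : z *m Z = lead_rV d (xz z) (yz z).
  by rewrite /lead_rV /Z; case: odd; rewrite coef_combination.
(* The constant term of a constant multiple of [p] is that constant times [p(0)]; the constant is
   read off at the top degree. *)
have keyq z : qf_eval A (z *m X0) = c * qf_eval A (z *m Z).
  rewrite X0E ZE /qf_eval -!/(bil _ _ _) -(coef0_diff_bil A _ (yz z) _ (yz z)).
  by rewrite (diff_bil_lead p_monic size_p) // coefZ mulrAC.
have keypol z z' : bil (polar b A) (z *m X0) (z' *m X0)
                 = c * bil (polar b A) (z *m Z) (z' *m Z).
  rewrite !X0E !ZE -(coef0_diff_bil _ _ (yz z) _ (yz z')).
  by rewrite (diff_bil_lead p_monic size_p) // coefZ mulrAC.
(* If [z *m Z = 0], the constant multiple of [p] attached to [z] is zero, and the parity of degrees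
   forces both polynomial vectors to vanish. *)
have uZ : Z \in unitmx.
  rewrite -row_free_unit; apply: inj_row_free => z zZ.
  have : diff_bil A (xz z) (yz z) (xz z) (yz z) = 0.
    rewrite (diff_bil_lead p_monic size_p) // -ZE zZ.
    by rewrite /bil !mul0mx mxE mulr0 scale0r.
  by move=> /(diff_bil_eq0 anA) [/XY0 XY0z /XY0z].
exists (invmx Z *m X0); split.
- rewrite -row_free_unit; apply: inj_row_free => z; rewrite mulmxA => zZ.
  have := keyq (z *m invmx Z); rewrite zZ mulmxKV // {1}/qf_eval !mul0mx mxE.
  by move/esym/eqP; rewrite mulf_eq0 (negPf c0) => /eqP/anA.
- by move=> x; rewrite mulmxA keyq mulmxKV.
- apply/matrixP=> i j.
  have := keypol (delta_mx 0 i *m invmx Z) (delta_mx 0 j *m invmx Z).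
  rewrite !mulmxKV // -!(mulmxA (delta_mx _ _)) bil_mul !bil_delta => ->.
  by rewrite [RHS]mxE.
Qed.
End Transfer.

(** * Splitting off hyperbolic planes *)

(** In the basis [u], [v], [C], pairing with [u] reads off the coordinate along [v], so the
    orthogonal of [u] is spanned by [u] and [C]. A vector of the span of [C] orthogonal to [C] is
    orthogonal to the whole basis, so regularity is inherited. *)
Lemma hyperbolic_complement (E : fieldType) b n (A : 'M[E]_n.+2) (u v : 'rV_n.+2)
    (C : 'M_(n, n.+2)) :
  admissible b A -> regular_form b A -> qf_eval A u = 0 ->
  u *m polar b A *m v^T = 1%:M -> u *m polar b A *m C^T = 0 ->
  v *m polar b A *m C^T = 0 -> row_free (col_mx u (col_mx v C)) ->
  [/\ u != 0, row_free (col_mx u C), (kermx (polar b A *m u^T) <= col_mx u C)%MS &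
      regular_form b (C *m A *m C^T)].
Proof.
move=> sA nA qu uv uC vC free_uvC.
have fuC : row_free (col_mx u C).
  apply: inj_row_free => z; rewrite -[z]hsubmxK mul_row_col => z0.
  have : row_mx (lsubmx z) (row_mx (0 : 'M_1) (rsubmx z)) = 0.
    by apply: (row_free_inj free_uvC); rewrite mul0mx !mul_row_col mul0mx add0r.
  by rewrite -row_mx0 => /eq_row_mx [-> ]; rewrite -row_mx0 => /eq_row_mx [_ ->];
    rewrite row_mx0.
have vu : v *m polar b A *m u^T = 1%:M.
  by apply: trmx_inj; rewrite !trmx_mul polar_tr // trmxK mulmxA uv trmx1.
have Cu := polar_perpC sA uC.
have unit_uvC : @col_mx _ 1 n.+1 n.+2 u (@col_mx _ 1 n n.+2 v C) \in unitmx.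
  by rewrite -row_free_unit.
split=> //.
- apply: contra_eq_neq uv => ->; rewrite !mul0mx eq_sym.
  by apply/eqP => /matrixP/(_ 0 0)/eqP; rewrite !mxE oner_eq0.
- set K := kermx _.
  have := mulmxKV unit_uvC K; set Z := K *m _ => defK.
  pose Z' : 'M_(_, 1 + (1 + n)) := Z.
  have {}defK : lsubmx Z' *m u + (lsubmx (rsubmx Z') *m v + rsubmx (rsubmx Z') *m C) = K.
    by rewrite -!mul_row_col !hsubmxK.
  have : K *m (polar b A *m u^T) = 0 by apply: mulmx_ker.
  rewrite -defK !mulmxDl -!mulmxA !(mulmxA _ (polar b A)) polar_diag //.
  rewrite vu Cu !mulmx0 add0r addr0 mulmx1 => ->.
  by rewrite mul0mx add0r -mul_row_col submxMl.
- move=> x; rewrite qf_eval_mul polarM !mulmxA => qx xC.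
  have xC0 : x *m C = 0.
    apply: nA => //; set y := x *m C in qx xC *.
    have yu : y *m polar b A *m u^T = 0 by rewrite -!mulmxA (mulmxA C) Cu mulmx0.
    have yv : y *m polar b A *m v^T = 0.
      by rewrite -!mulmxA (mulmxA C) (polar_perpC sA vC) mulmx0.
    apply: trmx_inj; rewrite trmx0.
    have := mulKmx unit_uvC ((y *m polar b A)^T) => <-.
    rewrite [X in _ *m X](_ : _ = 0) ?mulmx0 //.
    have yvC : y *m polar b A *m (col_mx v C)^T = 0.
      by rewrite tr_col_mx mul_mx_row yv xC row_mx0.
    apply: trmx_inj; rewrite trmx0 trmx_mul trmxK tr_col_mx mul_mx_row yu yvC.
    exact: row_mx0.
  have : row_mx 0 x *m col_mx u C = 0 by rewrite mul_row_col mul0mx add0r.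
  rewrite -(mul0mx _ (col_mx u C)) => /(row_free_inj fuC).
  by rewrite -row_mx0 => /eq_row_mx [].
Qed.

Section NormPrinciple.
Variables (F : fieldType) (K : fieldExtType F) (a : K) (p : {poly F}).
Local Notation d := (\dim {:K}).
Hypotheses (p_monic : p \is monic) (size_p : size p = d.+1).
Hypothesis p_min : forall f, horner_alg a f = 0 -> p %| f.
Local Notation c := ((-1) ^+ d * p`_0).
Hypotheses (a_neq0 : a != 0) (c_neq0 : c != 0).

(** Splitting off a plane lowers [n] by two and the isotropic rank by at most two, so the assumption
    of an isotropic subspace of half the dimension passes to the complement. *)
Lemma transfer_quo b n n' (A : 'M[F]_n) (u : 'rV_n) (C : 'M_(n', n)) m :
  admissible b A -> qf_eval A u = 0 -> u *m polar b A *m C^T = 0 -> u != 0 ->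
  (kermx (polar b A *m u^T) <= col_mx u C)%MS ->
  tiso_rank b (block_mx (map_mx (in_alg K) A) 0 0 (- a *: map_mx (in_alg K) A)) m.+2 ->
  tiso_rank b (block_mx (map_mx (in_alg K) (C *m A *m C^T)) 0 0
                 (- a *: map_mx (in_alg K) (C *m A *m C^T))) m.
Proof.
move=> sA qu uC u0 kerC; rewrite !map_mxM -map_trmx.
apply: tiso_rank_diff_quo (map_mx (in_alg K) u) _ _ _ _ _ _ _ _ _.
- by rewrite oppr_eq0.
- exact: admissible_map.
- by rewrite qf_eval_map qu rmorph0.
- exact: perp_map.
- by rewrite map_mx_eq0.
- exact: sub_perp_map.
Qed.

Lemma similar_hyperbolic n (A : 'M[F]_n.+2) (u v : 'rV_n.+2) (C : 'M_(n, n.+2)) e P :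
  e != 0 -> qf_eval A u = 0 ->
  u *m polar true A *m v^T = 1%:M -> u *m polar true A *m C^T = 0 ->
  v *m polar true A *m C^T = 0 -> row_free (col_mx u (col_mx v C)) ->
  P \in unitmx ->
  (forall x, qf_eval (C *m A *m C^T) (x *m P) = e * qf_eval (C *m A *m C^T) x) ->
  exists2 Q : 'M_n.+2, Q \in unitmx & forall x, qf_eval A (x *m Q) = e * qf_eval A x.
Proof.
move=> e0 qu uv uC vC free_uvC uP simP.
pose R : 'M_n.+2 := @col_mx _ 1 n.+1 n.+2 u (@col_mx _ 1 n n.+2 v C).
have uR : R \in unitmx by rewrite -row_free_unit.
have qE (r s : 'M_1) (x : 'rV_n) : qf_eval A (row_mx r (row_mx s x) *m R)
    = r 0 0 * s 0 0 + s 0 0 ^+ 2 * qf_eval A v + qf_eval (C *m A *m C^T) x.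
  rewrite !mul_row_col qf_eval_mul [r in LHS]mx11_scalar [s in LHS]mx11_scalar.
  rewrite !mul_scalar_mx [_ *: v + _]addrC.
  have buv : bil (A + A^T) u v = 1 by rewrite /bil uv mxE.
  have bux : bil (A + A^T) u (x *m C) = 0.
    by rewrite /bil trmx_mul mulmxA uC mul0mx mxE.
  have bxv : bil (A + A^T) (x *m C) v = 0.
    by rewrite /bil -!mulmxA (mulmxA C) (polar_perpC _ vC) // mulmx0 mxE.
  rewrite qf_evalD bilDZr qf_evalD !qf_evalZ qu.
  have -> : bil (A + A^T) (r 0 0 *: u) v = r 0 0 by rewrite bilZl buv mulr1.
  rewrite bilZl bux bilZr bxv; ring.
(* On the plane the map is [u -> e u], [v -> v + t u]; since [q(r u + s v) = r s + s^2 q(v)], this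
   [t] makes it a similarity of factor [e]. *)
pose t := (e - 1) * qf_eval A v.
pose N : 'M_(1 + (1 + n)) :=
  block_mx e%:M 0 (col_mx t%:M 0) (block_mx 1%:M 0 0 P).
have uN : N \in unitmx.
  rewrite unitmxE /N det_lblock det_lblock det1 mul1r det_scalar expr1.
  by rewrite unitrM -unitmxE uP andbT unitfE.
exists (invmx R *m (N : 'M_n.+2) *m R).
  by rewrite !unitmx_mul unitmx_inv uR uN.
move=> x; have [{}x ->] : exists y, x = y *m R by exists (x *m invmx R); rewrite mulmxKV.
rewrite !mulmxA mulmxK //.
pose y : 'rV_(1 + (1 + n)) := x; rewrite -[x]/y -[y]hsubmxK -[rsubmx y]hsubmxK.
set r := lsubmx y; set s := lsubmx _; set w := rsubmx _.
have -> : row_mx r (row_mx s w) *m N =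
    row_mx (e *: r + t *: s) (row_mx s (w *m P)).
  rewrite mul_row_block mul_row_col mul_row_block !mulmx0 !addr0 !add0r mulmx1.
  by rewrite !mul_mx_scalar.
rewrite !qE simP !mxE /t; ring.
Qed.

Lemma norm_principle_quadratic n (A : 'M[F]_n) : regular_form true A ->
  tiso_rank true (block_mx (map_mx (in_alg K) A) 0 0 (- a *: map_mx (in_alg K) A)) n ->
  exists2 P : 'M_n, P \in unitmx & forall x, qf_eval A (x *m P) = c * qf_eval A x.
Proof.
elim/ltn_ind: n A => n IHn A nA t; have sA : admissible true A by [].
have [anA | ] := classic (anisotropic A).
  have [P [uP simP _]] := transfer_anisotropic p_monic size_p p_min c_neq0 sA anA t.
  by exists P.
move=> /not_all_ex_not [u Hu]; have [qu /eqP u0] := imply_to_and _ _ Hu.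
have [n' [v [C [uv uC vC defn free_uvC]]]] := hyperbolic_split sA nA qu u0.
subst n.
have [_ _ kerC nC] := hyperbolic_complement sA nA qu uv uC vC free_uvC.
have [|P uP simP] := IHn n' _ _ nC (transfer_quo sA qu uC u0 kerC t); first by lia.
exact: similar_hyperbolic c_neq0 qu uv uC vC free_uvC uP simP.
Qed.

(** The plane of [u] and [v] is only metabolic and need not have [c] as a similarity factor, so the
    induction carries a Lagrangian of [B (+) -c B] instead of an isometry. *)
Lemma norm_principle_bilinear n (B : 'M[F]_n) : admissible false B ->
  regular_form false B ->
  tiso_rank false (block_mx (map_mx (in_alg K) B) 0 0 (- a *: map_mx (in_alg K) B)) n ->
  tiso_rank false (block_mx B 0 0 (- c *: B)) n.
Proof.
elim/ltn_ind: n B => n IHn B sB nB t.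
have [anB | ] := classic (anisotropic B).
  have [P [uP simP polP]] := transfer_anisotropic p_monic size_p p_min c_neq0 sB anB t.
  (* The graph of the similarity [P]. *)
  exists n, (row_mx P 1%:M); split; [|split].
  - suff /eqP -> : row_free (row_mx P 1%:M) by [].
    by apply/row_freeP; exists (col_mx 0 1%:M); rewrite mul_row_col mulmx0 add0r mulmx1.
  - move=> x; rewrite mul_mx_row mulmx1 qf_eval_block simP qf_eval_scale.
    by rewrite mulNr subrr.
  - rewrite /= tr_row_mx mul_row_block !mulmx0 addr0 add0r mul_row_col mul1mx trmx1 mulmx1.
    by rewrite polP scaleNr subrr.
move=> /not_all_ex_not [u Hu]; have [qu /eqP u0] := imply_to_and _ _ Hu.
have [n' [v [C [uv uC vC defn free_uvC]]]] := hyperbolic_split sB nB qu u0.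
subst n.
have [_ fuC kerC nC] := hyperbolic_complement sB nB qu uv uC vC free_uvC.
apply: (tiso_rank_diff_lift sB qu uC fuC); apply: IHn => //.
  exact: admissibleM.
exact: transfer_quo sB qu uC u0 kerC t.
Qed.
End NormPrinciple.

(** * Lagrangians and isometries of symmetric bilinear forms *)

Lemma ltn_rank_col_mx (E : fieldType) n k (Y : 'M[E]_(k, n)) (v : 'rV_n) :
  ~~ (v <= Y)%MS -> (\rank Y < \rank (col_mx v Y))%N.
Proof.
have YvY : (Y <= col_mx v Y)%MS by rewrite -addsmxE addsmxSr.
rewrite ltn_neqAle (mxrank_leqif_sup YvY).1 (mxrank_leqif_sup YvY).2 andbT.
by rewrite col_mx_sub submx_refl andbT.
Qed.

(** A vector space over any field, even with two elements, is not the union of two proper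
    subspaces. *)
Lemma avoid_two_hyperplanes (E : fieldType) n k (Y : 'M[E]_(k, n)) (h : 'cV_n) :
  (\rank Y < n)%N -> h != 0 ->
  exists v : 'rV_n, ~~ (v <= Y)%MS /\ v *m h != 0.
Proof.
move=> ltY h0.
have [v1 v1Y] : exists v : 'rV_n, ~~ (v <= Y)%MS.
  have /row_subPn [i iY] : ~~ (1%:M <= Y)%MS.
    by rewrite sub1mx; apply: contraL ltY => /eqP ->; rewrite ltnn.
  by exists (row i 1%:M).
have [v2 v2h] : exists v : 'rV_n, v *m h != 0.
  have /cV0Pn [i hi] := h0; exists (delta_mx 0 i).
  apply: contra_neq hi => /rowP/(_ 0).
  by rewrite -rowE !mxE.
have [v1h | v1h] := eqVneq (v1 *m h) 0; last by exists v1.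
have [v2Y | v2Y] := boolP (v2 <= Y)%MS; last by exists v2.
exists (v1 + v2); rewrite mulmxDl v1h add0r v2h; split=> //.
apply: contra v1Y => s; rewrite -(addrK v2 v1).
by rewrite addmx_sub // eqmx_opp.
Qed.

(* A Lagrangian subspace [T] of [B (+) -B'] is the graph of an isometry as soon as
   it projects onto the second factor.  If it does not, some [(u, 0)] lies in
   [T]; replacing [T] by [(T :&: w^perp) + <w>] with [w = (v, v)], isotropic
   since [B] and [B'] have the same diagonal, enlarges the projection. *)
Lemma bf_isometric_lagrangian (E : fieldType) n (B B' : 'M[E]_n) :
  B^T = B -> B'^T = B' -> B \in unitmx -> B' \in unitmx ->
  (forall x, qf_eval B x = qf_eval B' x) ->
  tiso_rank false (block_mx B 0 0 (- B')) n -> bf_isometric B B'.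
Proof.
move=> sB sB' uB uB' eqB [k [T [rT [_ /= tT]]]].
have [s] := ubnP (n - \rank (rsubmx T)); elim: s k T rT tT => // s IHs k T rT tT les.
have formE i j (X : 'M_(i, n)) Y (X' : 'M_(j, n)) Y' :
    row_mx X Y *m block_mx B 0 0 (- B') *m (row_mx X' Y')^T
    = X *m B *m X'^T - Y *m B' *m Y'^T.
  rewrite mul_row_block !mulmx0 addr0 add0r tr_row_mx mul_row_col.
  by rewrite mulmxN mulNmx.
have := tT; rewrite -[T]hsubmxK formE; set X := lsubmx T; set Y := rsubmx T in les *.
move=> /eqP; rewrite subr_eq0 => /eqP XY.
have [fullY | ltY] := leqP n (\rank Y).
  have /row_fullP [Z ZY] : row_full Y by rewrite -col_leq_rank.
  have B'E : B' = (Z *m X) *m B *m (Z *m X)^T.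
    rewrite trmx_mul !mulmxA -(mulmxA Z) -(mulmxA Z) XY !mulmxA ZY mul1mx.
    by rewrite -mulmxA -trmx_mul ZY trmx1 mulmx1.
  exists (Z *m X); split=> //.
  by move: uB'; rewrite {1}B'E !unitmx_mul => /andP [/andP []].
(* [Y] has smaller rank than [T], so [T] contains a nonzero vector with second component zero. *)
have [z [zY zT]] : exists z : 'rV_k, z *m Y = 0 /\ z *m T != 0.
  have /row_subPn [i iT] : ~~ (kermx Y <= kermx T)%MS.
    apply/negP => /mxrankS; rewrite !mxrank_ker.
    by have := rank_leq_row T; have := rank_leq_row Y; lia.
  exists (row i (kermx Y)); split; last by rewrite -sub_kermx.
  by rewrite -row_mul mulmx_ker row0.
pose u := z *m X.
have zTE : z *m T = row_mx u 0 by rewrite -[T]hsubmxK mul_mx_row zY.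
have u0 : u != 0 by apply: contra_neq zT => e; rewrite zTE e row_mx0.
have Bu0 : B *m u^T != 0.
  apply: contra_neq u0 => Bu; apply: trmx_inj; rewrite trmx0.
  by rewrite -(mulKmx uB u^T) Bu mulmx0.
have [v [vY vBu]] := avoid_two_hyperplanes ltY Bu0.
pose e := (v *m (B *m u^T)) 0 0.
have e0 : e != 0.
  by apply: contra_neq vBu => e0; apply/rowP=> j; rewrite ord1 [RHS]mxE.
pose w := row_mx v v.
pose l := T *m block_mx B 0 0 (- B') *m w^T.
(* [T] projected along [(u, 0)] onto the orthogonal of [w]; the second components are unchanged. *)
pose T' := T - (e^-1 *: l) *m (z *m T).
have uw : z *m T *m block_mx B 0 0 (- B') *m w^T = e%:M.
  rewrite zTE formE mul0mx mul0mx subr0; apply/rowP=> j; rewrite ord1.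
  by rewrite -[LHS]/(bil B u v) -{1}sB bil_tr /bil -mulmxA [RHS]mxE.
have T'w : T' *m block_mx B 0 0 (- B') *m w^T = 0.
  rewrite !mulmxBl -!(mulmxA (e^-1 *: l)) uw mul_mx_scalar scalerA divff //.
  by rewrite scale1r subrr.
have ww : w *m block_mx B 0 0 (- B') *m w^T = 0.
  rewrite formE; apply/rowP=> j; rewrite ord1 mxE.
  have := eqB v; rewrite /qf_eval => ->; rewrite [X in _ + X]mxE subrr mxE //.
have wT' : w *m block_mx B 0 0 (- B') *m T'^T = 0.
  apply: (@polar_perpC _ false) T'w; apply: admissible_block.
    by rewrite /admissible sB eqxx.
  by rewrite /admissible linearN /= sB' eqxx.
have T'T' : T' *m block_mx B 0 0 (- B') *m T'^T = 0.
  have -> : T' = (1%:M - e^-1 *: l *m z) *m T.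
    by rewrite mulmxBl mul1mx /T' mulmxA.
  by rewrite trmx_mul !mulmxA -!(mulmxA (1%:M - _)) tT !(mul0mx, mulmx0).
have rT' : rsubmx T' = Y.
  by rewrite /T' zTE linearB /= mul_mx_row row_mxKr mulmx0 subr0.
pose T1 := col_mx w T'.
apply: (IHs _ T1).
(* The projection loses at most one dimension, and [w] regains it, since its second component [v]
   lies outside the span of [Y]. *)
- have : ~~ (w <= T')%MS.
    apply: contra vY => /submxP [Z wE].
    by rewrite -[v](row_mxKr v v) -/w wE -mulmx_rsub rT' submxMl.
  move=> /ltn_rank_col_mx; apply: leq_trans.
  have TE : T = T' + (e^-1 *: l) *m (z *m T) by rewrite subrK.
  apply: (leq_trans rT); rewrite {1}TE; apply: (leq_trans (mxrank_add _ _)).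
  rewrite -[(\rank T').+1]addn1 leq_add2l.
  exact: leq_trans (mxrankM_maxr _ _) (rank_leq_row _).
- rewrite mul_col_mx tr_col_mx mul_col_row ww wT' T'w T'T'.
  exact: block_mx_const.
- have -> : rsubmx T1 = col_mx v Y.
    by rewrite /T1 -[T']hsubmxK -block_mxEv block_mxEh row_mxKr rT'.
  by have := ltn_rank_col_mx vY; have := rank_leq_col (col_mx v Y); lia.
Qed.

(** * The quadratic radical *)

Lemma qf_eval_eq0_alternating (E : fieldType) n (M : 'M[E]_n) :
  (forall x, qf_eval M x = 0) -> (forall i, M i i = 0) /\ M + M^T = 0.
Proof.
move=> q0; split=> [i|].
  by rewrite -bil_delta; apply: q0.
apply/matrixP=> i j; rewrite -bil_delta [RHS]mxE.
have := qf_evalD M (delta_mx 0 i) (delta_mx 0 j).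
by rewrite !q0 !add0r => <-.
Qed.

Lemma qf_eval_alternating (E : fieldType) n (M : 'M[E]_n) x :
  (forall i, M i i = 0) -> M + M^T = 0 -> qf_eval M x = 0.
Proof.
move=> diagM skewM; pose U : 'M[E]_n := \matrix_(i, j) if (i < j)%N then M i j else 0.
have -> : M = U - U^T.
  apply/matrixP=> i j; rewrite !mxE; case: ltngtP => [ij|ij|/val_inj ->].
  - by rewrite subr0.
  - have /matrixP/(_ i j) := skewM; rewrite !mxE => /eqP.
    by rewrite addr_eq0 sub0r => /eqP.
  - by rewrite subr0.
rewrite /qf_eval mulmxBr mulmxBl mxE.
have := bil_tr U x x; rewrite /bil => e.
by rewrite [X in _ + X]mxE e subrr.
Qed.

(** Over a finite field vanishing values do not by themselves give vanishing over extensions;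
    passing through alternating matrices turns them into identities between coefficients. *)
Lemma qf_eval_eq0_map (E L : fieldType) (f : {rmorphism E -> L}) n (M : 'M[E]_n) :
  (forall x, qf_eval M x = 0) -> forall y, qf_eval (map_mx f M) y = 0.
Proof.
move=> /qf_eval_eq0_alternating [diagM skewM] y; apply: qf_eval_alternating.
  by move=> i; rewrite mxE diagM rmorph0.
by rewrite map_trmx -map_mxD skewM map_mx0.
Qed.

Lemma tiso_quadratic (E : fieldType) n k (A : 'M[E]_n) (T : 'M_(k, n)) :
  (forall x, qf_eval A (x *m T) = 0) -> tiso true A T.
Proof.
move=> q0; split=> //; rewrite -polarM.
have /qf_eval_eq0_alternating [_] : forall x, qf_eval (T *m A *m T^T) x = 0.
  by move=> x; rewrite qf_eval_mul.
by [].
Qed.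

(** The quadratic radical is divided out one vector [u] at a time, as adding a multiple of [u] never
    changes the value. [Pi] is the projection to the quotient and [Si] a section of it. *)
Lemma regular_quotient (E : fieldType) n (A : 'M[E]_n) :
  exists n1 (Pi : 'M_(n, n1)) (Si : 'M_(n1, n)),
  [/\ Si *m Pi = 1%:M, regular_form true (Si *m A *m Si^T) &
      forall x, qf_eval A x = qf_eval (Si *m A *m Si^T) (x *m Pi)].
Proof.
elim/ltn_ind: n A => n IHn A.
have [nA | ] := classic (regular_form true A).
  by exists n, 1%:M, 1%:M; rewrite !mul1mx trmx1 mulmx1; split=> // x; rewrite mulmx1.
move=> /not_all_ex_not [u Hu]; have [qu {}Hu] := imply_to_and _ _ Hu.
have [polu /eqP u0] := imply_to_and _ _ Hu.
pose C := row_base (u^C)%MS.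
have ru : \rank u = 1%N.
  by apply/eqP; rewrite eqn_leq rank_leq_row lt0n mxrank_eq0.
have rC : \rank (u^C)%MS = n.-1 by rewrite mxrank_compl ru subn1.
have n0 : (0 < n)%N by rewrite -ru rank_leq_col.
have fullP : row_full (col_mx u C).
  rewrite -sub1mx -addsmxE; apply: submx_trans (_ : (_ <= u + u^C)%MS) _.
    by rewrite sub1mx addsmx_compl_full.
  by apply: addsmxS => //; rewrite eq_row_base.
have freeP : row_free (col_mx u C).
  rewrite -row_leq_rank (eqP fullP : \rank _ = n) rC; lia.
have [R RP] := row_fullP fullP.
have PR : col_mx u C *m R = 1%:M.
  by apply: (row_free_inj freeP); rewrite -mulmxA RP mulmx1 mul1mx.
move: C fullP freeP R RP PR; rewrite rC => C fullP freeP R RP PR.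
have CR : C *m rsubmx R = 1%:M.
  move: PR; rewrite -{1}[R]hsubmxK mul_col_row scalar_mx_block.
  by move=> /eq_block_mx [].
have qC x : qf_eval A x = qf_eval (C *m A *m C^T) (x *m rsubmx R).
  rewrite qf_eval_mul -[x in LHS]mulmx1 -RP -[R in LHS]hsubmxK mul_row_col mulmxDr.
  rewrite !mulmxA [x *m lsubmx R]mx11_scalar mul_scalar_mx.
  by rewrite (@qf_eval_shift _ true) // polu mul0mx.
have ltn : (n.-1 < n)%N by lia.
have [n1 [Pi [Si [SP nS qS]]]] := IHn _ ltn (C *m A *m C^T).
have SE : Si *m C *m A *m (Si *m C)^T = Si *m (C *m A *m C^T) *m Si^T.
  by rewrite trmx_mul !mulmxA.
exists n1, (rsubmx R *m Pi), (Si *m C); rewrite SE; split=> //.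
- by rewrite mulmxA -(mulmxA Si) CR mulmx1.
- by move=> x; rewrite qC qS (mulmxA x).
Qed.

(** [g X] acts as [X] on the image of the section [Si] and as the identity on the kernel of [Pi];
    [g] is multiplicative, so [g P] is invertible. *)
Lemma similar_quotient (E : fieldType) n n1 (A : 'M[E]_n) (A1 : 'M[E]_n1)
    (Pi : 'M_(n, n1)) (Si : 'M_(n1, n)) e P :
  Si *m Pi = 1%:M -> (forall x, qf_eval A x = qf_eval A1 (x *m Pi)) ->
  P \in unitmx -> (forall x, qf_eval A1 (x *m P) = e * qf_eval A1 x) ->
  exists2 Q, Q \in unitmx & forall x, qf_eval A (x *m Q) = e * qf_eval A x.
Proof.
move=> SP qA uP simP.
pose g (X : 'M[E]_n1) := 1%:M - Pi *m Si + Pi *m X *m Si.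
have gPi X : g X *m Pi = Pi *m X.
  by rewrite /g !mulmxDl mulNmx mul1mx -!mulmxA SP !mulmx1 subrr add0r.
have gg X Y : g X *m g Y = g (X *m Y).
  rewrite {2}/g mulmxDr mulmxBr mulmx1 !mulmxA !gPi {1}/g.
  by rewrite addrK /g mulmxA.
exists (g P).
  have /mulmx1_unit [] // : g P *m g (invmx P) = 1%:M.
  by rewrite gg mulmxV // /g mulmx1 subrK.
by move=> x; rewrite !qA -mulmxA gPi mulmxA simP.
Qed.

(** * The field norm *)

Lemma monic_dvd_irreducible_exp (F : fieldType) (p q : {poly F}) k :
  irreducible_poly p -> p \is monic -> q \is monic -> q %| p ^+ k ->
  exists m, q = p ^+ m.
Proof.
move=> irrp mp; elim: k q => [|k IHk] q mq.
  rewrite expr0 dvdp1 => /size_poly1P [e e0 qe]; exists 0%N.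
  by move: mq; rewrite qe monicE lead_coefC expr0 => /eqP ->.
have [/dvdpP [r qE] | ndvd] := boolP (p %| q).
  have mr : r \is monic by rewrite -(monicMr _ mp) -qE.
  rewrite qE exprSr dvdp_mul2r ?monic_neq0 // => /(IHk _ mr) [m ->].
  by exists m.+1; rewrite exprSr.
have co : coprimep q p by rewrite coprimep_sym irreducible_poly_coprime.
by rewrite exprS Gauss_dvdpr // => /(IHk _ mq).
Qed.

(** As [p(M) = 0], the scalar matrix [p(X)] equals [p(X) - p(M)], which is a multiple of [X - M];
    take determinants. *)
Lemma char_poly_dvd_exp (F : fieldType) n (M : 'M[F]_n.+1) (p : {poly F}) :
  horner_mx M p = 0 -> char_poly M %| p ^+ n.+1.
Proof.
move=> pM; pose X : 'M[{poly F}]_n.+1 := 'X%:M; pose M' := map_mx polyC M.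
have cXM : GRing.comm X M' by apply/esym/scalar_mxC.
pose S := \sum_(i < size p) (p`_i)%:P *: (\sum_(j < i) X ^+ (i.-1 - j) * M' ^+ j).
suff pE : p%:M = char_poly_mx M *m S.
  by rewrite -det_scalar pE det_mulmx dvdp_mulIl.
have -> : p%:M = \sum_(i < size p) (p`_i)%:P *: X ^+ i.
  rewrite -{1}[p]coefK poly_def raddf_sum /=; apply: eq_bigr => i _.
  by rewrite -mul_polyC -scale_scalar_mx; congr (_ *: _); rewrite /X -rmorphXn.
have p0 : \sum_(i < size p) (p`_i)%:P *: M' ^+ i = 0.
  have : map_mx polyC (horner_mx M p) = 0 by rewrite pM map_mx0.
  rewrite -{1}[p]coefK poly_def !raddf_sum /= => e; rewrite -[RHS]e; apply: eq_bigr => i _.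
  rewrite linearZ /= rmorphXn /= horner_mx_X map_mxZ; congr (_ *: _).
  by rewrite rmorphXn.
rewrite -[LHS]subr0 -[X in _ - X]p0 -sumrB mulmx_sumr; apply: eq_bigr => i _.
rewrite -scalerBr -scalemxAr; congr (_ *: _).
by rewrite subrXX_comm.
Qed.

(** The characteristic polynomial is a power of [p]; its degree gives the exponent [m] and its
    constant term the determinant. Annihilation is stated on iterates, the shape in which powers of
    [a] act on coordinates. *)
Lemma det_irreducible_annihilator (F : fieldType) n (M : 'M[F]_n) (p : {poly F}) d m :
  irreducible_poly p -> p \is monic -> size p = d.+1 -> n = (m * d)%N ->
  (forall v : 'rV_n, \sum_(i < size p) p`_i *: iter i (mulmx^~ M) v = 0) ->
  \det M = ((-1) ^+ d * p`_0) ^+ m.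
Proof.
move=> irrp mp sp nE killed.
have d0 : (0 < d)%N by have [] := irrp; rewrite sp.
case: n M nE killed => [|n] M nE killed.
  move/esym/eqP: nE; rewrite muln_eq0 (gtn_eqF d0) orbF => /eqP ->.
  by rewrite det_mx00.
have iterE i (v : 'rV_n.+1) : iter i (mulmx^~ M) v = v *m M ^+ i.
  elim: i => [|i IHi]; first by rewrite mulmx1.
  by rewrite iterS IHi exprSr -mulmxA.
have pM : horner_mx M p = 0.
  apply/row_matrixP=> k; rewrite row0 rowE -[RHS](killed (delta_mx 0 k)).
  rewrite -{1}[p]coefK poly_def raddf_sum mulmx_sumr; apply: eq_bigr => i _.
  by rewrite iterE /= linearZ /= rmorphXn /= horner_mx_X -scalemxAr.
have [k charE] := monic_dvd_irreducible_exp irrp mp (char_poly_monic M) (char_poly_dvd_exp pM).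
have km : k = m.
  have := size_char_poly M; rewrite charE => sz; have := size_exp p k; rewrite sz sp /= nE mulnC.
  by move/eqP; rewrite eqn_pmul2l // => /eqP.
have /(congr1 ( *%R ((-1) ^+ n.+1))) := char_poly_det M.
rewrite mulrA -expr2 sqrr_sign mul1r => <-.
rewrite charE km -horner_coef0 horner_exp horner_coef0 [in LHS]nE.
by rewrite exprMn -exprM mulnC.
Qed.

Import passmx.

Section FieldNorm.
Variables (F : fieldType) (L : fieldExtType F) (a : L) (p : {poly F}) (d m : nat).
Hypotheses (p_irr : irreducible_poly p) (p_monic : p \is monic) (size_p : size p = d.+1).
Hypotheses (p_root : horner_alg a p = 0) (dimL : \dim {:L} = (m * d)%N).

Lemma fnormE : fnorm a = ((-1) ^+ d * p`_0) ^+ m.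
Proof.
rewrite /fnorm; set e := vbasis {:L}.
have e_basis : basis_of {:L} e by apply: vbasisP.
apply: (det_irreducible_annihilator p_irr p_monic size_p dimL) => v.
have iterE i : iter i (mulmx^~ (mxof e e (linfun (fun x : L => a * x)))) v
    = rVof e (a ^+ i * vecof e v).
  elim: i => [|i IHi]; first by rewrite mul1r vecofK.
  rewrite iterS IHi -rVof_app //; congr rVof.
  by rewrite exprS -mulrA; exact: (lfunE (a \*o @idfun L : {linear L -> L})).
have : rVof e (horner_alg a p * vecof e v) = 0.
  by rewrite p_root mul0r linear0.
move=> e0; rewrite -[RHS]e0 -[p in RHS]coefK poly_def raddf_sum mulr_suml linear_sum.
apply: eq_bigr => i _; rewrite iterE /= linearZ /= rmorphXn /= horner_algX.
by rewrite -scalerAl mul1r -scalerAl linearZ.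
Qed.
End FieldNorm.

Lemma val_in_alg (F : fieldType) (L : fieldExtType F) (E : {subfield L}) (e : F) :
  vsval (e%:A : subvs_of E) = e%:A.
Proof. by rewrite linearZ /= algid1. Qed.

Lemma qf_evalB (E : fieldType) n (A D : 'M[E]_n) x :
  qf_eval (A - D) x = qf_eval A x - qf_eval D x.
Proof. by rewrite /qf_eval mulmxBr mulmxBl [LHS]mxE [X in _ + X]mxE. Qed.

(** * The norm principle when [L : F(a)] is odd *)

Section OddNormPrinciple.
Variables (F : fieldType) (L : fieldExtType F) (E : {subfield L}) (a : subvs_of E).
Variable p : {poly F}.
Local Notation d := (\dim {:subvs_of E}).
Local Notation c := ((-1) ^+ d * p`_0).
Hypotheses (p_monic : p \is monic) (size_p : size p = d.+1).
Hypothesis p_min : forall f, horner_alg a f = 0 -> p %| f.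
Hypotheses (a_neq0 : a != 0) (c_neq0 : c != 0) (odd_codim : odd (\dim_E {:L})).

Lemma tiso_rank_odd_descent b n (A : 'M[F]_n) m : admissible b A ->
  tiso_rank b (block_mx (ext_mx L A) 0 0 (- val a *: ext_mx L A)) m ->
  tiso_rank b (block_mx (map_mx (in_alg (subvs_of E)) A) 0 0
                 (- a *: map_mx (in_alg (subvs_of E)) A)) m.
Proof.
move=> sA t; have sA' := admissible_map (in_alg (subvs_of E)) sA.
have H k (D : 'M[subvs_of E]_k) := springer odd_codim (A := D).
apply: (tiso_rank_descent H); first by apply/admissible_block/admissibleZ.
have extE : map_mx vsval (map_mx (in_alg (subvs_of E)) A) = ext_mx L A.
  by apply/matrixP=> i j; rewrite !mxE; apply: val_in_alg.
by rewrite map_block_mx map_mxZ !map_mx0 extE.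
Qed.

Lemma odd_norm_quadratic n (A : 'M[F]_n) : qf_simfactor (ext_mx L A) (val a) ->
  exists2 P : 'M_n, P \in unitmx & forall x, qf_eval A (x *m P) = c * qf_eval A x.
Proof.
move=> [_ [P [uP simP]]].
have [n1 [Pi [Si [SP rA1 qA]]]] := regular_quotient A.
set A1 := Si *m A *m Si^T in rA1 qA; clearbody A1.
have qL y : qf_eval (ext_mx L A) y = qf_eval (ext_mx L A1) (y *m map_mx (in_alg L) Pi).
  have : qf_eval (map_mx (in_alg L) (A - Pi *m A1 *m Pi^T)) y = 0.
    by apply: qf_eval_eq0_map => x; rewrite qf_evalB qf_eval_mul -qA subrr.
  rewrite map_mxB !map_mxM -map_trmx qf_evalB qf_eval_mul.
  by move/eqP; rewrite subr_eq0 => /eqP.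
have [] := @norm_principle_quadratic _ _ a p p_monic size_p p_min a_neq0 c_neq0 _ A1 rA1.
  apply: tiso_rank_odd_descent => //.
  (* The image in the quotient of the graph of the similarity over [L]; its rank is at least [n1]
     because [Pi] has the left inverse [Si]. *)
  pose T := row_mx (P *m map_mx (in_alg L) Pi) (map_mx (in_alg L) Pi).
  exists n, T; split.
    have := mxrankM_maxr Si Pi; rewrite SP mxrank1 => /leq_trans; apply.
    rewrite -(mxrank_map (in_alg L)).
    have -> : map_mx (in_alg L) Pi = T *m col_mx 0 1%:M.
      by rewrite mul_row_col mulmx0 add0r mulmx1.
    exact: mxrankM_maxl.
  apply: tiso_quadratic => z; rewrite mul_mx_row qf_eval_block qf_eval_scale mulmxA.
  by rewrite -!qL -simP qf_eval_scale mulNr subrr.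
by move=> P1; apply: similar_quotient SP qA.
Qed.

Lemma odd_norm_bilinear n (B : 'M[F]_n) : B^T = B -> B \in unitmx ->
  bf_simfactor (ext_mx L B) (val a) -> bf_isometric B (c *: B).
Proof.
move=> sB uB [_ [P [uP simP]]].
have sB' : admissible false B by rewrite /admissible sB eqxx.
have rB : regular_form false B.
  by move=> x _ xB; rewrite -(mulmxK uB x) xB mul0mx.
have qsim : qf_simfactor (ext_mx L B) (val a).
  by split=> //; exists P; split=> // x; rewrite simP qf_eval_mul.
(* The quadratic case for [B(x, x)], which may be singular as a quadratic form although [B] is not:
   it gives [P0 *m B *m P0^T] the same diagonal form as [c *: B]. *)
have [P0 uP0 simP0] := odd_norm_quadratic qsim.
have t : tiso_rank false (block_mx B 0 0 (- c *: B)) n.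
  apply: (@norm_principle_bilinear _ _ a p p_monic size_p p_min a_neq0 c_neq0) => //.
  apply: tiso_rank_odd_descent => //.
  exists n, (row_mx P 1%:M); split; [|split].
  - suff /eqP -> : row_free (row_mx P 1%:M) by [].
    by apply/row_freeP; exists (col_mx 0 1%:M); rewrite mul_row_col mulmx0 add0r mulmx1.
  - move=> x; rewrite mul_mx_row mulmx1 qf_eval_block qf_eval_scale.
    by rewrite -qf_eval_mul -simP qf_eval_scale mulNr subrr.
  - rewrite /= tr_row_mx mul_row_block !mulmx0 addr0 add0r mul_row_col mul1mx trmx1 mulmx1.
    by rewrite -simP scaleNr subrr.
have [P1 [uP1 P1E]] : bf_isometric (P0 *m B *m P0^T) (c *: B).
  apply: bf_isometric_lagrangian.
  - by rewrite !trmx_mul trmxK sB mulmxA.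
  - by rewrite linearZ /= sB.
  - by rewrite !unitmx_mul unitmx_tr uP0 uB.
  - by rewrite unitmxE detZ unitrM -unitmxE uB unitrX ?unitfE.
  - by move=> x; rewrite qf_eval_mul simP0 qf_eval_scale.
  - rewrite -scaleNr; apply: (@tiso_rank_congr _ _ _ _ _ (block_mx (invmx P0) 0 0 1%:M)).
      by rewrite row_free_unit unitmxE det_ublock det1 mulr1 -unitmxE unitmx_inv.
    by rewrite block_congr !mulmxA mulVmx // mul1mx -mulmxA -trmx_mul mulVmx // trmx1 mulmx1.
exists (P1 *m P0); rewrite unitmx_mul uP1 uP0; split=> //.
by rewrite P1E trmx_mul !mulmxA.
Qed.

End OddNormPrinciple.

(** * Square factors and the conclusion *)

Lemma qf_isometric_sqr (F : fieldType) n (A : 'M[F]_n) c e :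
  e != 0 -> (exists2 P : 'M_n, P \in unitmx & forall x, qf_eval A (x *m P) = c * qf_eval A x) ->
  qf_isometric A (c * e ^+ 2 *: A).
Proof.
move=> e0 [P uP simP]; exists (e *: P).
split; first by rewrite unitmxZ ?unitfE.
by move=> x; rewrite -scalemxAr qf_evalZ simP qf_eval_scale; ring.
Qed.

Lemma bf_isometric_sqr (F : fieldType) n (B : 'M[F]_n) c e :
  e != 0 -> bf_isometric B (c *: B) -> bf_isometric B (c * e ^+ 2 *: B).
Proof.
move=> e0 [P [uP simP]]; exists (e *: P).
split; first by rewrite unitmxZ ?unitfE.
rewrite linearZ /= -!scalemxAl -scalemxAr -simP !scalerA; congr (_ *: _); ring.
Qed.

(* With [E = F(a)] and [p] the minimal polynomial of [a]. *)
Lemma fnorm_minPoly (F : fieldType) (L : fieldExtType F) (a : L) : a != 0 ->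
  exists (E : {subfield L}) (a' : subvs_of E) (p : {poly F}),
  [/\ val a' = a, p \is monic, size p = (\dim {:subvs_of E}).+1,
      forall f, horner_alg a' f = 0 -> p %| f &
      p`_0 != 0 /\
      fnorm a = ((-1) ^+ (\dim {:subvs_of E}) * p`_0) ^+ (\dim_E {:L})].
Proof.
move=> a0; pose E : {subfield L} := <<1; a>>%AS.
have /polyOver1P [p pE] := minPolyOver 1%AS a.
pose a' := vsproj E a.
have aE : val a' = a by rewrite /= vsprojK ?memv_adjoin.
have horner_algE f : horner_alg a f = (map_poly (in_alg L) f).[a] by [].
have evE f : vsval (horner_alg a' f) = horner_alg a f.
  rewrite horner_algE -[LHS]/(vsval (map_poly (in_alg (subvs_of E)) f).[a']).
  rewrite -horner_map -map_poly_comp [X in _.[X]]aE; congr (_.[_]).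
  by apply: eq_map_poly => e; apply: val_in_alg.
have mp : p \is monic by rewrite -(map_monic (in_alg L)) -pE monic_minPoly.
have p_min f : horner_alg a f = 0 -> p %| f.
  move=> f0; rewrite -(dvdp_map (in_alg L)) -pE; apply: minPoly_dvdp.
    by apply/polyOver1P; exists f.
  by rewrite /root -horner_algE f0.
have dimE : \dim {:subvs_of E} = \dim E by rewrite dimvf.
have sp : size p = (\dim E).+1.
  by rewrite -(size_map_poly (in_alg L)) -pE size_minPoly [\dim E]dim_Fadjoin dimv1 muln1.
have p_root : horner_alg a p = 0 by rewrite horner_algE -pE minPolyxx.
have p_neq0 := monic_neq0 mp.
have irrp : irreducible_poly p.
  split=> [|q sq /dvdpP [r pE']]; first by rewrite sp ltnS adim_gt0.
  have qp : q %| p by rewrite pE' dvdp_mulIr.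
  rewrite /eqp qp /=; apply: (p_min); move/eqP: p_root.
  rewrite pE' rmorphM mulf_eq0 => /orP [/eqP ra | /eqP //].
  have := p_neq0; rewrite {1}pE' mulf_eq0 negb_or => /andP [r0 q0].
  have := dvdp_leq r0 (p_min _ ra); rewrite pE' size_mul //.
  move: sq q0; rewrite -size_poly_eq0; lia.
have p0 : p`_0 != 0.
  apply: contra_neq a0 => p0.
  have /irrp : 'X %| p by rewrite -['X]subr0 dvdp_XsubCl /root horner_coef0 p0.
  rewrite size_polyX => /(_ isT) /andP [_ /dvdpP [s /(congr1 (horner_alg a))]].
  by rewrite horner_algX rmorphM /= p_root mulr0.
exists E, a', p; rewrite dimE; split=> //.
  by move=> f f0; apply: p_min; rewrite -evE f0.
split=> //; apply: (fnormE irrp mp sp p_root).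
exact: dim_sup_field (subvf E).
Qed.

Theorem theorem7p3 (F : fieldType) (L : fieldExtType F) (hchar : 2%N \in [pchar F]) :
  (forall (n : nat) (A : 'M[F]_n) (a : L),
      qf_simfactor (ext_mx L A) a -> qf_simfactor A (fnorm a)) /\
  (forall (n : nat) (B : 'M[F]_n), B^T = B -> B \in unitmx ->
      forall a : L, bf_simfactor (ext_mx L B) a -> bf_simfactor B (fnorm a)).
Proof.
split=> [n A a simA | n B sB uB a simB].
  have [a0 _] := simA.
  have [E [a' [p [aE mp sp p_min [p0 ->]]]]] := fnorm_minPoly a0.
  set c := _ * _; have c0 : c != 0 by rewrite mulf_neq0 ?expf_neq0 ?oppr_eq0 ?oner_eq0.
  split; first exact: expf_neq0.
  (* With [m] the exponent, [c^m] is a square times [c] or 1 according to the parity of [m], so only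
     odd [m] requires the norm principle. *)
  rewrite -[X in _ ^+ X]odd_double_half exprD -muln2 exprM.
  apply: qf_isometric_sqr; first exact: expf_neq0.
  case: (boolP (odd _)) => oddm; last first.
    by exists 1%:M; rewrite ?unitmx1 // => x; rewrite mulmx1 mul1r.
  rewrite expr1; apply: (odd_norm_quadratic mp sp p_min) => //.
    by apply: contra_neq a0 => a'0; rewrite -aE a'0.
  by rewrite aE.
have [a0 _] := simB.
have [E [a' [p [aE mp sp p_min [p0 ->]]]]] := fnorm_minPoly a0.
set c := _ * _; have c0 : c != 0 by rewrite mulf_neq0 ?expf_neq0 ?oppr_eq0 ?oner_eq0.
split; first exact: expf_neq0.
rewrite -[X in _ ^+ X]odd_double_half exprD -muln2 exprM.
apply: bf_isometric_sqr; first exact: expf_neq0.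
case: (boolP (odd _)) => oddm; last first.
  by exists 1%:M; rewrite unitmx1 scale1r trmx1 mulmx1 mul1mx.
rewrite expr1; apply: (odd_norm_bilinear mp sp p_min) => //.
  by apply: contra_neq a0 => a'0; rewrite -aE a'0.
by rewrite aE.
Qed.
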